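(* Let $\Omega\subset\mathbb{H}$ be a circular domain and let $g\in\mathcal{R}(\Omega)$ with $g^s\equiv1$. If $g$ has a $*$-logarithm, then: (1) if $\Omega$ is a slice domain and $q_0$ is a non-real isolated zero of $g_v$, then $g(q_0)=1$; (2) if $\Omega$ is a product domain and $q_0,q_1$ are non-real isolated zeroes of $g_v$, then either $g(q_0)=g(q_1)=1$ or $g(q_0)=g(q_1)=-1$.
   Context: $\mathbb{H}$ is the algebra of quaternions; $q=q_0+q_v$ with $q_0$ real and $q_v$ purely imaginary, $q^c=q_0-q_v$, $\mathbb{S}=\{I\in\mathbb{H}: I^2=-1\}$, $\mathbb{C}_I=\mathbb{R}+\mathbb{R}I$, $\mathbb{S}_q=\{q_0+\|q_v\|J: J\in\mathbb{S}\}$, $\Omega_I=\Omega\cap\mathbb{C}_I$. A domain (nonempty connected open set) $\Omega\subset\mathbb{H}$ is circular if $\mathbb{S}_q\subset\Omega$ for all $q\in\Omega$; it is a slice domain if $\Omega\cap\mathbb{R}\neq\emptyset$ and a product domain if $\Omega\cap\mathbb{R}=\emptyset$. A function $f:\Omega\to\mathbb{H}$ is slice regular if $f(\alpha+I\beta)=F_0(\alpha+\sqrt{-1}\beta)+I F_1(\alpha+\sqrt{-1}\beta)$ for all $I\in\mathbb{S}$ and $\alpha,\beta\in\mathbb{R}$ with $\alpha+I\beta\in\Omega$, where $F_0,F_1:\{\alpha+\sqrt{-1}\beta:\alpha+I\beta\in\Omega\}\to\mathbb{H}$ are $C^1$, $F_0(\bar z)=F_0(z)$, $F_1(\bar z)=-F_1(z)$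 and $\partial_\alpha F_0=\partial_\beta F_1$, $\partial_\beta F_0=-\partial_\alpha F_1$. $\mathcal{R}(\Omega)$ is the set of slice regular functions; $f\in\mathcal{R}(\Omega)$ is slice preserving if $f(\Omega_I)\subset\mathbb{C}_I$ for all $I\in\mathbb{S}$, and $\mathcal{R}_{\mathbb{R}}(\Omega)$ is the set of slice preserving functions. The $*$-product is $(f*g)(q)=0$ if $f(q)=0$, and $(f*g)(q)=f(q)\,g(f(q)^{-1}qf(q))$ otherwise; with pointwise sum it makes $\mathcal{R}(\Omega)$ an associative algebra. The slice conjugate $f^c$ is the function induced by $(F_0^c,F_1^c)$ (pointwise conjugates), and $f^s=f*f^c$. Every $f\in\mathcal{R}(\Omega)$ is uniquely $f=f_0+f_1i+f_2j+f_3k$ with $f_\ell\in\mathcal{R}_{\mathbb{R}}(\Omega)$; $f_0$ is its real part and $f_v=f-f_0$ its vector part. $\exp_*(f)=\sum_{n\ge0}f^{*n}/n!$, with $f^{*n}$ the $n$-th $*$-power. A $*$-logarithm of $g$ is an $f\in\mathcal{R}(\Omega)$ with $\exp_*(f)=g$. Non-real isolated zeroes: let $f\in\mathcal{R}(\Omega)$ with $f^s\not\equiv0$ and $q_0\in\Omega\setminus\mathbb{R}$. Write $f=\Delta^m\tilde f$ with $m\ge0$ the largest integer for which this is possible with $\tilde f\in\mathcal{R}(\Omega)$, where $\Delta(q)=q^2-2q\,\mathrm{Re}(q_0)+|q_0|^2$ (so $\tilde f\not\equiv0$ on $\mathbb{S}_{q_0}$). The point $q_0$ is a non-real isolated zero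 of $f$ if $\tilde f(q_0)=0$. If $f^s\equiv0$, $f$ has no non-real isolated zeroes. *)

(* Defs.v *)
From HB Require Import structures.
From mathcomp Require Import all_boot all_order all_algebra ring lra.
From mathcomp Require Import all_classical all_reals all_analysis.

Set Implicit Arguments.
Unset Strict Implicit.
Unset Printing Implicit Defensive.

Import Order.TTheory GRing.Theory Num.Theory.
Import numFieldNormedType.Exports.

Local Open Scope classical_set_scope.
Local Open Scope ring_scope.

(* The topology and the real normed space structure of [quat R] are those of
   'rV[R]_4, whose library norm [`|q|] is the sup norm; the Euclidean norm of
   a quaternion is [qnorm] below. The two norms are equivalent. *)
Definition quat (R : realType) : Type := 'rV[R]_4.

HB.instance Definition _ (R : realType) := NormedModule.copy (quat R) 'rV[R]_4.
HB.instance Definition _ (R : realType) := Complete.copy (quat R) 'rV[R]_4.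

Section Quaternions.
Context {R : realType}.
Implicit Types (x y z q : quat R).

Definition mkquat (a b c d : R) : quat R := \row_(l < 4) [:: a; b; c; d]`_l.

Definition re q : R := q ord0 (@Ordinal 4 0 isT).
Definition imi q : R := q ord0 (@Ordinal 4 1 isT).
Definition imj q : R := q ord0 (@Ordinal 4 2 isT).
Definition imk q : R := q ord0 (@Ordinal 4 3 isT).

Lemma quatP x y : re x = re y -> imi x = imi y -> imj x = imj y ->
  imk x = imk y -> x = y.
Proof.
move=> e0 e1 e2 e3; apply/rowP => -[[|[|[|[|//]]]] lt_l4].
- by rewrite (_ : Ordinal lt_l4 = @Ordinal 4 0 isT)//; apply/val_inj.
- by rewrite (_ : Ordinal lt_l4 = @Ordinal 4 1 isT)//; apply/val_inj.
- by rewrite (_ : Ordinal lt_l4 = @Ordinal 4 2 isT)//; apply/val_inj.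
- by rewrite (_ : Ordinal lt_l4 = @Ordinal 4 3 isT)//; apply/val_inj.
Qed.

Lemma re_mk a b c d : re (mkquat a b c d) = a. Proof. by rewrite /re mxE. Qed.
Lemma imi_mk a b c d : imi (mkquat a b c d) = b. Proof. by rewrite /imi mxE. Qed.
Lemma imj_mk a b c d : imj (mkquat a b c d) = c. Proof. by rewrite /imj mxE. Qed.
Lemma imk_mk a b c d : imk (mkquat a b c d) = d. Proof. by rewrite /imk mxE. Qed.

Lemma reD x y : re (x + y) = re x + re y. Proof. by rewrite /re mxE. Qed.
Lemma imiD x y : imi (x + y) = imi x + imi y. Proof. by rewrite /imi mxE. Qed.
Lemma imjD x y : imj (x + y) = imj x + imj y. Proof. by rewrite /imj mxE. Qed.
Lemma imkD x y : imk (x + y) = imk x + imk y. Proof. by rewrite /imk mxE. Qed.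

Lemma reZ (a : R) x : re (a *: x) = a * re x. Proof. by rewrite /re mxE. Qed.
Lemma imiZ (a : R) x : imi (a *: x) = a * imi x. Proof. by rewrite /imi mxE. Qed.
Lemma imjZ (a : R) x : imj (a *: x) = a * imj x. Proof. by rewrite /imj mxE. Qed.
Lemma imkZ (a : R) x : imk (a *: x) = a * imk x. Proof. by rewrite /imk mxE. Qed.

Lemma re0 : re 0 = 0. Proof. by rewrite /re mxE. Qed.
Lemma imi0 : imi 0 = 0. Proof. by rewrite /imi mxE. Qed.
Lemma imj0 : imj 0 = 0. Proof. by rewrite /imj mxE. Qed.
Lemma imk0 : imk 0 = 0. Proof. by rewrite /imk mxE. Qed.

Definition quatE := (re_mk, imi_mk, imj_mk, imk_mk, reD, imiD, imjD, imkD,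
  reZ, imiZ, imjZ, imkZ, re0, imi0, imj0, imk0).

Definition qmul x y : quat R := mkquat
  (re x * re y - imi x * imi y - imj x * imj y - imk x * imk y)
  (re x * imi y + imi x * re y + imj x * imk y - imk x * imj y)
  (re x * imj y - imi x * imk y + imj x * re y + imk x * imi y)
  (re x * imk y + imi x * imj y - imj x * imi y + imk x * re y).

Let one : quat R := mkquat 1 0 0 0.

Fact qmulA : associative qmul.
Proof. by move=> x y z; apply: quatP; rewrite /qmul !quatE; ring. Qed.
Fact qmul1q : left_id one qmul.
Proof. by move=> x; apply: quatP; rewrite /qmul !quatE; ring. Qed.
Fact qmulq1 : right_id one qmul.
Proof. by move=> x; apply: quatP; rewrite /qmul !quatE; ring. Qed.
Fact qmulDl : left_distributive qmul +%R.
Proof. by move=> x y z; apply: quatP; rewrite /qmul !quatE; ring. Qed.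
Fact qmulDr : right_distributive qmul +%R.
Proof. by move=> x y z; apply: quatP; rewrite /qmul !quatE; ring. Qed.
Fact qone_neq0 : one != 0.
Proof.
by apply/eqP => /(congr1 re); rewrite !quatE => /eqP; rewrite oner_eq0.
Qed.

HB.instance Definition _ := GRing.Zmodule_isNzRing.Build (quat R)
  qmulA qmul1q qmulq1 qmulDl qmulDr qone_neq0.

Lemma qmulE x y : x * y = qmul x y. Proof. by []. Qed.
Lemma qoneE : 1 = mkquat 1 0 0 0 :> quat R. Proof. by []. Qed.

Fact qscaleAl (a : R) x y : a *: (x * y) = (a *: x) * y.
Proof. by apply: quatP; rewrite !qmulE /qmul !quatE; ring. Qed.
HB.instance Definition _ := GRing.Lmodule_isLalgebra.Build R (quat R) qscaleAl.

Fact qscaleAr (a : R) x y : a *: (x * y) = x * (a *: y).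
Proof. by apply: quatP; rewrite !qmulE /qmul !quatE; ring. Qed.
HB.instance Definition _ := GRing.Lalgebra_isAlgebra.Build R (quat R) qscaleAr.

Definition qconj q : quat R := mkquat (re q) (- imi q) (- imj q) (- imk q).
Definition qvec q : quat R := mkquat 0 (imi q) (imj q) (imk q).
Definition qnormsq q : R := re q ^+ 2 + imi q ^+ 2 + imj q ^+ 2 + imk q ^+ 2.
Definition qnorm q : R := Num.sqrt (qnormsq q).

Let qinv q : quat R := (qnormsq q)^-1 *: qconj q.

Lemma qnormsq_eq0 q : (qnormsq q == 0) = (q == 0).
Proof.
apply/eqP/eqP => [q0|->]; last by rewrite /qnormsq !quatE; ring.
have sq0 (a b c d : R) : a ^+ 2 + b ^+ 2 + c ^+ 2 + d ^+ 2 = 0 -> a = 0.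
  move=> e; apply/eqP; rewrite -sqrf_eq0 eq_le sqr_ge0 andbT.
  have := sqr_ge0 b; have := sqr_ge0 c; have := sqr_ge0 d; lra.
by apply: quatP; rewrite !quatE; [apply: (sq0 _ (imi q) (imj q) (imk q))
  | apply: (sq0 _ (re q) (imj q) (imk q)) | apply: (sq0 _ (re q) (imi q) (imk q))
  | apply: (sq0 _ (re q) (imi q) (imj q))]; rewrite -q0 /qnormsq; ring.
Qed.

Fact qmulVq : {in [pred q | q != 0], left_inverse 1 qinv *%R}.
Proof.
move=> q; rewrite inE -qnormsq_eq0 => q0; apply: quatP;
  rewrite qoneE qmulE /qmul /qinv /qconj !quatE; move: q0; rewrite /qnormsq => q0;
  by field.
Qed.
Fact qmulqV : {in [pred q | q != 0], right_inverse 1 qinv *%R}.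
Proof.
move=> q; rewrite inE -qnormsq_eq0 => q0; apply: quatP;
  rewrite qoneE qmulE /qmul /qinv /qconj !quatE; move: q0; rewrite /qnormsq => q0;
  by field.
Qed.
Fact qunitP x y : y * x = 1 /\ x * y = 1 -> [pred q | q != 0] x.
Proof.
case=> yx _; apply/negP => /eqP x0; move/eqP: yx.
by rewrite x0 mulr0 eq_sym oner_eq0.
Qed.
Fact qinv_out : {in [predC [pred q | q != 0]], qinv =1 id}.
Proof.
move=> q; rewrite !inE negbK => /eqP ->; apply: quatP;
  by rewrite /qinv /qconj !quatE ?oppr0 mulr0.
Qed.
HB.instance Definition _ := GRing.NzRing_hasMulInverse.Build (quat R)
  qmulVq qmulqV qunitP qinv_out.

Lemma qinvE q : q^-1 = (qnormsq q)^-1 *: qconj q. Proof. by []. Qed.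

Definition qi : quat R := mkquat 0 1 0 0.
Definition qj : quat R := mkquat 0 0 1 0.
Definition qk : quat R := mkquat 0 0 0 1.

Definition imag_units : set (quat R) := [set I | I ^+ 2 = -1].

Definition slice_pt (I : quat R) (p : R * R) : quat R := p.1%:A + p.2 *: I.

Definition complex_plane (I : quat R) : set (quat R) := range (slice_pt I).

Definition sphere (q : quat R) : set (quat R) :=
  [set slice_pt J (re q, qnorm (qvec q)) | J in imag_units].

Definition qreal : set (quat R) := [set q | qvec q = 0].

Definition circular_domain (Omega : set (quat R)) : Prop :=
  [/\ Omega !=set0, open Omega, connected Omega &
      forall q, Omega q -> sphere q `<=` Omega].

Definition slice_domain (Omega : set (quat R)) : Prop :=
  circular_domain Omega /\ Omega `&` qreal !=set0.

Definition product_domain (Omega : set (quat R)) : Prop :=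
  circular_domain Omega /\ Omega `&` qreal = set0.

(* A function on [Omega] is represented by a total function on [quat R]; only
   its values on [Omega] matter. Likewise C is identified with R * R and a stem
   function is a total function on R * R of which only the values on
   [stem_dom Omega], which is open when [Omega] is a circular domain, matter. *)

Definition stem_dom (Omega : set (quat R)) : set (R * R) :=
  [set p | exists2 I, imag_units I & Omega (slice_pt I p)].

Definition d_alpha (F : R * R -> quat R) : R * R -> quat R := 'D_(1, 0) F.
Definition d_beta (F : R * R -> quat R) : R * R -> quat R := 'D_(0, 1) F.

(* Only meaningful for open [D], since the limits are not taken within [D]. *)
Definition C1_on (D : set (R * R)) (F : R * R -> quat R) : Prop :=
  forall p, D p -> [/\ derivable F p (1, 0), derivable F p (0, 1),
    {for p, continuous (d_alpha F)} & {for p, continuous (d_beta F)}].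

Definition holomorphic_stem (D : set (R * R)) (F0 F1 : R * R -> quat R) : Prop :=
  [/\ C1_on D F0, C1_on D F1,
      forall p, D p -> F0 (p.1, - p.2) = F0 p /\ F1 (p.1, - p.2) = - F1 p &
      forall p, D p -> d_alpha F0 p = d_beta F1 p /\ d_beta F0 p = - d_alpha F1 p].

Definition induced_by (Omega : set (quat R)) (F0 F1 : R * R -> quat R)
    (f : quat R -> quat R) : Prop :=
  forall I p, imag_units I -> Omega (slice_pt I p) ->
    f (slice_pt I p) = F0 p + I * F1 p.

Definition slice_regular (Omega : set (quat R)) (f : quat R -> quat R) : Prop :=
  exists F0 F1, holomorphic_stem (stem_dom Omega) F0 F1 /\ induced_by Omega F0 F1 f.

Definition slice_preserving (Omega : set (quat R)) (f : quat R -> quat R) : Prop :=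
  slice_regular Omega f /\
  forall I, imag_units I -> f @` (Omega `&` complex_plane I) `<=` complex_plane I.

Definition star (f g : quat R -> quat R) : quat R -> quat R :=
  fun q => if f q == 0 then 0 else f q * g ((f q)^-1 * q * f q).

Definition star_pow (f : quat R -> quat R) (n : nat) : quat R -> quat R :=
  iter n (star f) (fun=> 1).

Definition slice_conj_of (Omega : set (quat R)) (f fc : quat R -> quat R) : Prop :=
  exists F0 F1, [/\ holomorphic_stem (stem_dom Omega) F0 F1,
    induced_by Omega F0 F1 f & induced_by Omega (qconj \o F0) (qconj \o F1) fc].

(* [h] is f^s = f * f^c on [Omega]. *)
Definition symmetrization_of (Omega : set (quat R)) (f h : quat R -> quat R) : Prop :=
  exists fc, slice_conj_of Omega f fc /\
    forall q, Omega q -> star f fc q = h q.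

(* [fv] is f_v = f - f_0 on [Omega], where f = f_0 + f_1 i + f_2 j + f_3 k is
   the unique such decomposition. A *-product whose left factor is slice
   preserving is the pointwise product. *)
Definition vector_part_of (Omega : set (quat R)) (f fv : quat R -> quat R) : Prop :=
  exists f0 f1 f2 f3,
    [/\ slice_preserving Omega f0, slice_preserving Omega f1,
        slice_preserving Omega f2 & slice_preserving Omega f3] /\
    forall q, Omega q ->
      f q = f0 q + f1 q * qi + f2 q * qj + f3 q * qk /\ fv q = f q - f0 q.

(* exp_*(f) = g on [Omega]; the series is summed pointwise. *)
Definition exp_star_is (Omega : set (quat R)) (f g : quat R -> quat R) : Prop :=
  forall q, Omega q -> series (fun n => n`!%:R^-1 *: star_pow f n q) @ \oo --> g q.

Definition has_star_log (Omega : set (quat R)) (g : quat R -> quat R) : Prop :=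
  exists2 f, slice_regular Omega f & exp_star_is Omega f g.

Definition Delta (q0 q : quat R) : quat R :=
  q ^+ 2 - 2 * q * (re q0)%:A + (qnorm q0 ^+ 2)%:A.

Definition Delta_factor (Omega : set (quat R)) (q0 : quat R) (m : nat)
    (f ft : quat R -> quat R) : Prop :=
  slice_regular Omega ft /\ forall q, Omega q -> f q = Delta q0 q ^+ m * ft q.

Definition nonreal_isolated_zero (Omega : set (quat R)) (f : quat R -> quat R)
    (q0 : quat R) : Prop :=
  [/\ slice_regular Omega f, ~ symmetrization_of Omega f (fun=> 0),
      (Omega `\` qreal) q0 &
      exists m ft, [/\ Delta_factor Omega q0 m f ft,
        forall m' ft', Delta_factor Omega q0 m' f ft' -> (m' <= m)%N &
        ft q0 = 0]].

End Quaternions.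

(* Main.v *)
From HB Require Import structures.
Require Import Defs.
From mathcomp Require Import all_boot all_order all_algebra ring lra.
From mathcomp Require Import complex.
From mathcomp Require Import all_classical all_reals all_analysis.

Set Implicit Arguments.
Unset Strict Implicit.
Unset Printing Implicit Defensive.

Import Order.TTheory GRing.Theory Num.Theory.
Import numFieldNormedType.Exports.

Local Open Scope classical_set_scope.
Local Open Scope ring_scope.

(** A slice function is the same thing as a stem, that is a holomorphic map [A]
into the complexified quaternions with [A] of the conjugate of [z] equal to the
conjugate of [A z]; star products become pointwise products. Write a value as
[A = a + v] with a complex scalar [a] and a complex vector [v = (v1, v2, v3)], and
let [h = v1 ^ 2 + v2 ^ 2 + v3 ^ 2], so that [v] squares to [- h]. All powers of [A]
lie in the span of [1] and [v], and the exponential of [A] is [P + rho v] with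
[P ^ 2 + h rho ^ 2 = exp (2 a)], and with [P = exp a] when [h = 0]
([exp_star_components], from [exp_scalar_vector]).

Let [a + v] be the stem of a logarithm of [g]. The hypothesis on the
symmetrization says [P ^ 2 + h rho ^ 2 = 1], hence [exp a] is [1] or [-1] at every
point. It is continuous, so the sign is the same on the whole domain, and it is
[+] if the domain meets the real axis, where [a] is real. It remains to show that
[g] takes the value [exp a] at a nonreal isolated zero [q0] of its vector part
([isolated_zero_value]).

For this it is enough that [h] vanishes at the corresponding point [z0]. Let [T]
be the stem of the quotient of [g_v = rho v] by the largest possible power of
[Delta]. Where [Delta] is not zero, [T] is parallel to [v], hence also at [z0] by
continuity. Because the induced function is zero at [q0], the square sum of
[T z0] is zero ([ccoord_sqnorm_eq0]). If [h] were not zero at [z0], a null vector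
would be parallel to a vector off the null cone and thus be zero
([null_parallel]). But if [T] vanishes at [z0], then also at its conjugate, and
another factor [Delta] can be split off ([Delta_factor_vanish]), which contradicts
the choice of the power.

Splitting off a factor requires that [u z / (z - z0)] is again of class C1 when
[u] is a C1 solution of the Cauchy-Riemann equations with a zero at [z0]
([hol_division]). This follows from Cauchy's formula for a small circle, which is
obtained by shrinking the circle to a point ([cauchy_formula]): the quotient is
the Cauchy transform of [u], and a Cauchy transform is holomorphic inside the
circle ([hol_cauchy_transform]). *)

(** * Functions of class C1 on the plane *)

Lemma differentiable_littleo (K : numFieldType) (V W : normedModType K)
    (f : V -> W) (L : {linear V -> W}) x : continuous L ->
  (forall e : K, 0 < e ->
    \forall v \near 0, `|f (v + x) - f x - L v| <= e * `|v|) ->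
  differentiable f x /\ 'd f x = L :> (V -> W).
Proof.
move=> cL fL.
have fo : f \o shift x = cst (f x) + L +o_ 0 id.
  apply/eqaddoP => e e0; have := fL e e0; apply: filterS => v.
  by rewrite !fctE /= opprD addrA.
have dE := diff_unique cL fo.
by split => //; apply/diff_locallyP; rewrite dE.
Qed.

Section C1.
Context {R : realType}.
Implicit Types (f g : R * R -> R) (p q : R * R).

Lemma pairDE (a b c d : R) : (a, b) + (c, d) = (a + c, b + d) :> R * R.
Proof. by []. Qed.

Lemma pairZE (h a b : R) : h *: ((a, b) : R * R) = (h * a, h * b) :> R * R.
Proof. by []. Qed.

(** The mean value theorem is applied to [t |-> g (x + t * h)] on the unit
interval, so that the sign of [h] does not matter. *)
Lemma mvt_linear_bound (g g' : R -> R) (x h a e : R) :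
  (forall t : R, 0 <= t <= 1 -> is_derive (x + t * h) 1 g (g' (x + t * h))) ->
  (forall t : R, 0 <= t <= 1 -> `|g' (x + t * h) - a| <= e) ->
  `|g (x + h) - g x - h * a| <= e * `|h|.
Proof.
move=> dg bg.
pose k t := g (x + t * h).
have dk (t : R) : 0 <= t <= 1 -> is_derive t 1 k (h * g' (x + t * h)).
  move=> t01; have d1 : is_derive t 1 (fun t => x + t * h) h.
    rewrite (_ : (fun t => _) = cst x + h \*: id); last first.
      by apply/funext => s; rewrite !fctE /= mulrC.
    by apply: is_derive_eq; rewrite add0r [_ *: _]mulr1.
  have d2 := dg t t01.
  have := @is_derive1_comp _ g (fun t => x + t * h) t _ _ d2 d1.
  by rewrite mulrC.
have [||c c01 kc] := @MVT_segment _ k (fun t => h * g' (x + t * h)) 0 1 ler01.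
- by move=> t; rewrite in_itv/= => /andP[t0 t1]; apply: dk; rewrite !ltW.
- apply: derivable_within_continuous => t; rewrite in_itv/= => t01.
  by have [] := dk t t01.
move: kc; rewrite /k mul1r mul0r addr0 subr0 mulr1 => ->.
rewrite -mulrBr normrM mulrC ler_wpM2r//; apply: bg.
by move: c01; rewrite in_itv.
Qed.

Lemma is_derive_slice1 f (s y : R) :
  derivable f (s, y) (1, 0) ->
  is_derive s 1 (fun s => f (s, y)) ('D_(1, 0) f (s, y)).
Proof.
move=> df.
have E : (fun h => h^-1 *: ((fun s => f (s, y)) (h *: 1 + s) - f (s, y))) =
    (fun h => h^-1 *: (f (h *: (1, 0) + (s, y)) - f (s, y))).
  apply/funext => h; congr (_ *: (f _ - _)).
  by rewrite pairZE pairDE mulr0 add0r.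
by split; rewrite /derivable /derive E.
Qed.

Lemma is_derive_slice2 f (x s : R) :
  derivable f (x, s) (0, 1) ->
  is_derive s 1 (fun s => f (x, s)) ('D_(0, 1) f (x, s)).
Proof.
move=> df.
have E : (fun h => h^-1 *: ((fun s => f (x, s)) (h *: 1 + s) - f (x, s))) =
    (fun h => h^-1 *: (f (h *: (0, 1) + (x, s)) - f (x, s))).
  apply/funext => h; congr (_ *: (f _ - _)).
  by rewrite pairZE pairDE mulr0 add0r.
by split; rewrite /derivable /derive E.
Qed.

(** The partial derivatives exist near [p] but are continuous only at [p]: this
is all that differentiability at [p] needs, and it lets a derivative that is
controlled at a single point be used there. *)
Definition C1at f p :=
  [/\ \forall q \near p, derivable f q (1, 0) /\ derivable f q (0, 1),
      {for p, continuous ('D_(1, 0) f)} & {for p, continuous ('D_(0, 1) f)}].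

Definition dlin (a b : R) (v : R * R) : R := v.1 * a + v.2 * b.

Fact dlin_linear a b : linear (dlin a b).
Proof. by move=> k u v; rewrite /dlin/= /GRing.scale/=; ring. Qed.
HB.instance Definition _ a b :=
  GRing.isLinear.Build R (R * R)%type R _ (dlin a b) (dlin_linear a b).

Lemma dlin_continuous a b : continuous (dlin a b).
Proof.
move=> p; apply: cvgD; apply: cvgM; try exact: cvg_cst.
exact: cvg_fst. exact: cvg_snd.
Qed.

(** The increment is split into one step along each axis; on each step the
mean value inequality compares the partial derivative with its value at [p]. *)
Lemma C1at_differentiable f p : C1at f p ->
  differentiable f p /\
  'd f p = dlin ('D_(1, 0) f p) ('D_(0, 1) f p) :> (R * R -> R).
Proof.
case=> df c1 c2; set L := dlin _ _.
have cL : continuous L by exact: dlin_continuous.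
apply: (@differentiable_littleo _ _ _ f L p cL) => e e0.
have e2 : 0 < e / 2 by rewrite divr_gt0.
move/cvgrPdist_le : c1 => /(_ _ e2) c1.
move/cvgrPdist_le : c2 => /(_ _ e2) c2.
have /nbhs_ballP[d /= d0 bd] : nbhs p ([set q | derivable f q (1, 0) /\
    derivable f q (0, 1)] `&` ([set q | `|'D_(1, 0) f p - 'D_(1, 0) f q| <= e / 2]
    `&` [set q | `|'D_(0, 1) f p - 'D_(0, 1) f q| <= e / 2])).
  exact: filterI df (filterI c1 c2).
apply/nbhs_ballP; exists d => //= -[v1 v2] /=.
case=> nv1 nv2.
have nv2' : `|v2| < d by move: nv2; rewrite /ball/= sub0r normrN.
have nv1' : `|v1| < d by move: nv1; rewrite /ball/= sub0r normrN.
case: p @L c1 c2 df bd {cL} => [p1 p2] L _ _ _ bd.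
have inb t u : `|t| < d -> `|u| < d -> ball (p1, p2) d (p1 + t, p2 + u).
  by move=> td ud; split; rewrite /ball/= opprD addNKr normrN.
have D1 t u : `|t| < d -> `|u| < d ->
    derivable f (p1 + t, p2 + u) (1, 0) /\
    `|'D_(1, 0) f (p1 + t, p2 + u) - 'D_(1, 0) f (p1, p2)| <= e / 2.
  by move=> td ud; have [[h _] [h' _]] := bd _ (inb _ _ td ud); rewrite distrC.
have D2 u : `|u| < d ->
    derivable f (p1, p2 + u) (0, 1) /\
    `|'D_(0, 1) f (p1, p2 + u) - 'D_(0, 1) f (p1, p2)| <= e / 2.
  have z : `|0 : R| < d by rewrite normr0.
  move=> ud; have [[_ h] [_ h']] := bd _ (inb _ _ z ud).
  by move: h h'; rewrite /= addr0 distrC.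
have tv v t : 0 <= t <= 1 -> `|v| < d -> `|t * v| < d.
  by move=> /andP[t0 t1]; rewrite normrM; apply: le_lt_trans;
    rewrite ger0_norm// ler_piMl.
have E1 : `|f (p1 + v1, p2 + v2) - f (p1, p2 + v2) - v1 * 'D_(1, 0) f (p1, p2)|
    <= e / 2 * `|v1|.
  apply: (@mvt_linear_bound (fun s => f (s, p2 + v2))
     (fun s => 'D_(1, 0) f (s, p2 + v2))) => t t01;
    have [h h'] := D1 _ _ (tv _ _ t01 nv1') nv2'.
    exact: is_derive_slice1.
  exact: h'.
have E2 : `|f (p1, p2 + v2) - f (p1, p2) - v2 * 'D_(0, 1) f (p1, p2)|
    <= e / 2 * `|v2|.
  apply: (@mvt_linear_bound (fun s => f (p1, s))
     (fun s => 'D_(0, 1) f (p1, s))) => t t01;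
    have [h h'] := D2 _ (tv _ _ t01 nv2').
    exact: is_derive_slice2.
  exact: h'.
have -> : (v1, v2) + (p1, p2) = (p1 + v1, p2 + v2).
  by rewrite [p1 + _]addrC [p2 + _]addrC.
rewrite /dlin /=; move: ('D_(1, 0) f (p1, p2)) ('D_(0, 1) f (p1, p2)) E1 E2.
move=> a b E1 E2.
have -> : f (p1 + v1, p2 + v2) - f (p1, p2) - (v1 * a + v2 * b) =
    (f (p1 + v1, p2 + v2) - f (p1, p2 + v2) - v1 * a) +
    (f (p1, p2 + v2) - f (p1, p2) - v2 * b) by ring.
apply: le_trans (ler_normD _ _) _; apply: le_trans (lerD E1 E2) _.
have m1 : `|v1| <= `|(v1, v2)| by rewrite prod_normE /= le_max lexx.
have m2 : `|v2| <= `|(v1, v2)| by rewrite prod_normE /= le_max lexx orbT.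
rewrite [e in leRHS]splitr mulrDl.
by apply: lerD; rewrite ler_pM2l.
Qed.

Lemma C1at_continuous f p : C1at f p -> {for p, continuous f}.
Proof. by move=> /C1at_differentiable[/differentiable_continuous]. Qed.

Lemma C1at_derivable f p : C1at f p ->
  derivable f p (1, 0) /\ derivable f p (0, 1).
Proof. by case=> /nbhs_singleton. Qed.

Lemma near_eq_continuous (T U : topologicalType) (h k : T -> U) (x : T) :
  {near x, h =1 k} -> {for x, continuous h} -> {for x, continuous k}.
Proof.
move=> hk; rewrite /prop_for /continuous_at -(nbhs_singleton hk).
by apply: cvg_trans; apply: near_eq_cvg.
Qed.

Lemma C1at_intro f (f1 f2 : R * R -> R) p :
  (\forall q \near p, is_derive (q : R * R) (1, 0) f (f1 q) /\ is_derive q (0, 1) f (f2 q)) ->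
  {for p, continuous f1} -> {for p, continuous f2} -> C1at f p.
Proof.
move=> df c1 c2; split.
- by apply: filterS df => q [[? _] [? _]].
- have e : {near p, 'D_(1, 0) f =1 f1} by apply: filterS df => q [[_ ->]].
  by apply: near_eq_continuous c1; apply: filterS e => q ->.
- have e : {near p, 'D_(0, 1) f =1 f2} by apply: filterS df => q [_ [_ ->]].
  by apply: near_eq_continuous c2; apply: filterS e => q ->.
Qed.

Lemma C1at_near_eq f g p : (\forall q \near p, f q = g q) -> C1at f p -> C1at g p.
Proof.
move=> /near_join fg [df c1 c2].
apply: (@C1at_intro _ ('D_(1, 0) f) ('D_(0, 1) f)); [|exact c1|exact c2].
apply: filterS2 fg df => q fg [d1 d2].
by split; apply: (near_eq_is_derive fg); apply: derivableP.
Qed.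

Lemma C1at_cst (c : R) p : C1at (fun=> c) p.
Proof.
apply: (@C1at_intro _ (cst 0) (cst 0)); try exact: cst_continuous.
by apply: (@filterE _ (nbhs p)) => q; split; apply: is_derive_cst.
Qed.

Lemma C1at_dlin a b p : C1at (dlin a b) p.
Proof.
have D q v : is_derive q v (dlin a b) (dlin a b v).
  have dq : differentiable (dlin a b) q.
    exact/linear_differentiable/dlin_continuous.
  split; first exact: diff_derivable.
  by rewrite deriveE// diff_lin//; exact: dlin_continuous.
apply: (@C1at_intro _ (cst (dlin a b (1, 0))) (cst (dlin a b (0, 1))));
  try exact: cst_continuous.
by apply: (@filterE _ (nbhs p)) => q; split; apply: D.
Qed.

Lemma C1at_fst p : C1at fst p.
Proof.
rewrite (_ : fst = dlin 1 0); first exact: C1at_dlin.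
by apply/funext => q; rewrite /dlin mulr1 mulr0 addr0.
Qed.

Lemma C1at_snd p : C1at snd p.
Proof.
rewrite (_ : snd = dlin 0 1); first exact: C1at_dlin.
by apply/funext => q; rewrite /dlin mulr1 mulr0 add0r.
Qed.

Lemma C1atD f g p : C1at f p -> C1at g p -> C1at (f + g) p.
Proof.
move=> [df f1 f2] [dg g1 g2].
apply: (@C1at_intro _ ('D_(1, 0) f + 'D_(1, 0) g) ('D_(0, 1) f + 'D_(0, 1) g)).
- apply: filterS2 df dg => q [a b] [c d].
  split; [exact: is_deriveD (derivableP a) (derivableP c)|].
  exact: is_deriveD (derivableP b) (derivableP d).
- exact: continuousD f1 g1.
- exact: continuousD f2 g2.
Qed.

Lemma C1atM f g p : C1at f p -> C1at g p -> C1at (f * g) p.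
Proof.
move=> fp gp; have cf := C1at_continuous fp; have cg := C1at_continuous gp.
move: fp gp => [df f1 f2] [dg g1 g2].
apply: (@C1at_intro _ (f * 'D_(1, 0) g + g * 'D_(1, 0) f)
  (f * 'D_(0, 1) g + g * 'D_(0, 1) f)).
- apply: filterS2 df dg => q [a b] [c d].
  split; [exact: is_deriveM (derivableP a) (derivableP c)|].
  exact: is_deriveM (derivableP b) (derivableP d).
- exact: continuousD (continuousM cf g1) (continuousM cg f1).
- exact: continuousD (continuousM cf g2) (continuousM cg f2).
Qed.

Lemma C1atN f p : C1at f p -> C1at (- f) p.
Proof.
move=> [df f1 f2].
apply: (@C1at_intro _ (- 'D_(1, 0) f) (- 'D_(0, 1) f)).
- apply: filterS df => q [a b].
  by split; [exact: is_deriveN (derivableP a)|exact: is_deriveN (derivableP b)].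
- exact: continuousN f1.
- exact: continuousN f2.
Qed.

Lemma C1atV f p : f p != 0 -> C1at f p -> C1at (fun q => (f q)^-1) p.
Proof.
move=> fp0 fp; have cf := C1at_continuous fp.
have f0 : \forall q \near p, f q != 0 by exact: (cvgr_neq0 _ cf).
move: fp => [df f1 f2].
apply: (@C1at_intro _ (fun q => - (f q) ^- 2 *: 'D_(1, 0) f q)
  (fun q => - (f q) ^- 2 *: 'D_(0, 1) f q)).
- apply: filterS2 df f0 => q [a b] q0; split.
  + by split; [exact: derivableV q0 a|exact: deriveV q0 a].
  + by split; [exact: derivableV q0 b|exact: deriveV q0 b].
- apply: cvgM; last exact: f1.
  apply: cvgN; apply: cvgV; first by rewrite expf_neq0.
  exact: cvgM.
- apply: cvgM; last exact: f2.
  apply: cvgN; apply: cvgV; first by rewrite expf_neq0.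
  exact: cvgM.
Qed.

End C1.

(** * The Cauchy-Riemann equations *)

Section Hol.
Context {R : realType}.
Local Notation C := (complex R).
Local Notation Re := (@complex.Re R).
Local Notation Im := (@complex.Im R).
Implicit Types (u v : R * R -> C) (p q : R * R).

Lemma complex_eq (x y : C) : Re x = Re y -> Im x = Im y -> x = y.
Proof. by case: x => a b; case: y => c d /= -> ->. Qed.

Lemma cReM (x y : C) : Re (x * y) = Re x * Re y - Im x * Im y.
Proof. by case: x; case: y. Qed.
Lemma cImM (x y : C) : Im (x * y) = Re x * Im y + Im x * Re y.
Proof. by case: x => a b; case: y => c d; rewrite /=. Qed.
Lemma cReD (x y : C) : Re (x + y) = Re x + Re y.
Proof. by case: x; case: y. Qed.
Lemma cImD (x y : C) : Im (x + y) = Im x + Im y.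
Proof. by case: x; case: y. Qed.
Lemma cReN (x : C) : Re (- x) = - Re x.
Proof. by case: x. Qed.
Lemma cImN (x : C) : Im (- x) = - Im x.
Proof. by case: x. Qed.
Lemma cReV (x : C) : Re x^-1 = Re x * (Re x * Re x + Im x * Im x)^-1.
Proof. by case: x => a b; rewrite /= -!expr2. Qed.
Lemma cImV (x : C) : Im x^-1 = - (Im x * (Re x * Re x + Im x * Im x)^-1).
Proof. by case: x => a b; rewrite /= -!expr2. Qed.
Definition cplxE := (cReM, cImM, cReD, cImD, cReN, cImN).

Lemma sqmod_neq0 (x : C) : x != 0 -> Re x * Re x + Im x * Im x != 0.
Proof.
case: x => a b /=; apply: contraNneq => e.
have a0 : a = 0 by apply/eqP; rewrite -sqrf_eq0; apply/eqP; nra.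
have b0 : b = 0 by apply/eqP; rewrite -sqrf_eq0; apply/eqP; nra.
by rewrite a0 b0.
Qed.

Definition cplx p : C := (p.1 +i* p.2)%C.

Definition CR u p :=
  'D_(1, 0) (Re \o u) p = 'D_(0, 1) (Im \o u) p /\
  'D_(0, 1) (Re \o u) p = - 'D_(1, 0) (Im \o u) p.

(** The real form of holomorphy at [p]; the derivative is [cder]. *)
Definition hol u p := [/\ C1at (Re \o u) p, C1at (Im \o u) p & CR u p].

Definition cder u p : C := ('D_(1, 0) (Re \o u) p +i* 'D_(1, 0) (Im \o u) p)%C.

Lemma derive_mulE (f g : R * R -> R) p (w : R * R) a b :
  derivable f p w -> derivable g p w -> 'D_w f p = a -> 'D_w g p = b ->
  'D_w (f * g) p = f p * b + g p * a.
Proof. by move=> df dg <- <-; rewrite (deriveM df dg). Qed.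

Lemma hol_near_eq u v p : (\forall q \near p, u q = v q) -> hol u p -> hol v p.
Proof.
move=> uv [c1 c2 [e1 e2]].
have h1 : \forall q \near p, (Re \o u) q = (Re \o v) q.
  by apply: filterS uv => q /= ->.
have h2 : \forall q \near p, (Im \o u) q = (Im \o v) q.
  by apply: filterS uv => q /= ->.
split; [exact: C1at_near_eq c1|exact: C1at_near_eq c2|].
by split; rewrite -?(near_eq_derive _ h1) -?(near_eq_derive _ h2).
Qed.

Lemma hol_cst (c : C) p : hol (fun=> c) p.
Proof.
split; [exact: C1at_cst|exact: C1at_cst|].
by split; rewrite !derive_cst ?oppr0.
Qed.

Lemma hol_cplx p : hol cplx p.
Proof.
split; [exact: C1at_fst|exact: C1at_snd|].
have D a b w : 'D_w (dlin a b) p = dlin a b w.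
  rewrite deriveE ?diff_lin//; try exact: dlin_continuous.
  exact/linear_differentiable/dlin_continuous.
rewrite /CR; have -> : (Re \o cplx) = dlin 1 0.
  by apply/funext => q; rewrite /dlin/= mulr1 mulr0 addr0.
have -> : (Im \o cplx) = dlin 0 1.
  by apply/funext => q; rewrite /dlin/= mulr1 mulr0 add0r.
by rewrite !D /dlin /=; split; ring.
Qed.

Lemma holD u v p : hol u p -> hol v p -> hol (fun q => u q + v q) p.
Proof.
move=> [u1 u2 [e1 e2]] [v1 v2 [g1 g2]].
have E1 : (Re \o (fun q => u q + v q)) = (Re \o u) + (Re \o v).
  by apply/funext => q; rewrite /= cReD.
have E2 : (Im \o (fun q => u q + v q)) = (Im \o u) + (Im \o v).
  by apply/funext => q; rewrite /= cImD.
have [u1a u1b] := C1at_derivable u1; have [u2a u2b] := C1at_derivable u2.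
have [v1a v1b] := C1at_derivable v1; have [v2a v2b] := C1at_derivable v2.
split; rewrite ?E1 ?E2; [exact: C1atD|exact: C1atD|].
split; rewrite E1 E2 (deriveD u1a v1a, deriveD u1b v1b).
  by rewrite (deriveD u2b v2b) e1 g1.
by rewrite (deriveD u2a v2a) e2 g2 opprD.
Qed.

Lemma holM u v p : hol u p -> hol v p -> hol (fun q => u q * v q) p.
Proof.
move=> [u1 u2 [e1 e2]] [v1 v2 [g1 g2]].
have E1 : (Re \o (fun q => u q * v q)) =
    (Re \o u) * (Re \o v) + - ((Im \o u) * (Im \o v)).
  by apply/funext => q; rewrite /= cReM.
have E2 : (Im \o (fun q => u q * v q)) =
    (Re \o u) * (Im \o v) + (Im \o u) * (Re \o v).
  by apply/funext => q; rewrite /= cImM.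
have [u1a u1b] := C1at_derivable u1; have [u2a u2b] := C1at_derivable u2.
have [v1a v1b] := C1at_derivable v1; have [v2a v2b] := C1at_derivable v2.
rewrite /hol /CR E1 E2; split.
- exact: C1atD (C1atM u1 v1) (C1atN (C1atM u2 v2)).
- exact: C1atD (C1atM u1 v2) (C1atM u2 v1).
- have M11a := derivableM u1a v1a; have M11b := derivableM u1b v1b.
  have M22a := derivableM u2a v2a; have M22b := derivableM u2b v2b.
  have M12a := derivableM u1a v2a; have M12b := derivableM u1b v2b.
  have M21a := derivableM u2a v1a; have M21b := derivableM u2b v1b.
  rewrite (deriveD M11a (derivableN M22a)) (deriveD M12b M21b) (deriveN M22a).
  rewrite (deriveD M11b (derivableN M22b)) (deriveD M12a M21a) (deriveN M22b).
  rewrite (derive_mulE u1a v1a e1 g1) (derive_mulE u2a v2a erefl erefl).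
  rewrite (derive_mulE u1b v2b e2 erefl) (derive_mulE u2b v1b erefl g2).
  rewrite (derive_mulE u1b v1b e2 g2) (derive_mulE u2b v2b erefl erefl).
  rewrite (derive_mulE u1a v2a e1 erefl) (derive_mulE u2a v1a erefl g1).
  move: ('D_(1, 0) _ p) ('D_(1, 0) _ p) ('D_(0, 1) _ p) ('D_(0, 1) _ p).
  by move=> a b c d; rewrite /=; split; ring.
Qed.

Lemma holN u p : hol u p -> hol (fun q => - u q) p.
Proof.
move=> hu; have := holM (hol_cst (-1) p) hu.
by under eq_fun do rewrite mulN1r.
Qed.

Lemma holV u p : u p != 0 -> hol u p -> hol (fun q => (u q)^-1) p.
Proof.
move=> up0 [u1 u2 [e1 e2]].
set N : R * R -> R := (Re \o u) * (Re \o u) + (Im \o u) * (Im \o u).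
have Np : N p != 0 by exact: sqmod_neq0.
have E1 : (Re \o (fun q => (u q)^-1)) = (Re \o u) * (fun q => (N q)^-1).
  by apply/funext => q; rewrite /= cReV.
have E2 : (Im \o (fun q => (u q)^-1)) = - ((Im \o u) * (fun q => (N q)^-1)).
  by apply/funext => q; rewrite /= cImV.
have NC : C1at N p by exact: C1atD (C1atM u1 u1) (C1atM u2 u2).
have VC := C1atV Np NC.
have [u1a u1b] := C1at_derivable u1; have [u2a u2b] := C1at_derivable u2.
have [Va Vb] := C1at_derivable VC.
have dV (w : R * R) a b : derivable (Re \o u) p w -> derivable (Im \o u) p w ->
    'D_w (Re \o u) p = a -> 'D_w (Im \o u) p = b ->
    'D_w (fun q => (N q)^-1) p =
    - ((N p)^-1 ^+ 2 * (2 * (Re (u p) * a + Im (u p) * b))).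
  move=> da db Da Db; have dN : derivable N p w.
    exact: derivableD (derivableM da da) (derivableM db db).
  rewrite (deriveV Np dN) -exprVn scaleNr; congr (- (_ * _)).
  rewrite (deriveD (derivableM da da) (derivableM db db)).
  rewrite (derive_mulE da da Da Da) (derive_mulE db db Db Db) /=; ring.
rewrite /hol /CR E1 E2; split.
- exact: C1atM u1 VC.
- exact: C1atN (C1atM u2 VC).
- have M1a := derivableM u1a Va; have M1b := derivableM u1b Vb.
  have M2a := derivableM u2a Va; have M2b := derivableM u2b Vb.
  rewrite (deriveN M2a) (deriveN M2b).
  have Da := dV _ _ _ u1a u2a e1 erefl; have Db := dV _ _ _ u1b u2b e2 erefl.
  rewrite (derive_mulE u1a Va e1 Da) (derive_mulE u2a Va erefl Da).
  rewrite (derive_mulE u1b Vb e2 Db) (derive_mulE u2b Vb erefl Db).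
  have NpE : N p = Re (u p) * Re (u p) + Im (u p) * Im (u p) by [].
  move: Np; rewrite /= NpE.
  move: ('D_(1, 0) _ p) ('D_(0, 1) _ p) (Re (u p)) (Im (u p)) => a b x y xy0.
  by split; field.
Qed.

Lemma hol_differentiable u p : hol u p ->
  [/\ differentiable (Re \o u) p, differentiable (Im \o u) p &
   forall w, 'd (Re \o u) p w = Re (cder u p * cplx w) /\
             'd (Im \o u) p w = Im (cder u p * cplx w)].
Proof.
move=> [u1 u2 [e1 e2]].
have [d1 E1] := C1at_differentiable u1; have [d2 E2] := C1at_differentiable u2.
split => // w; rewrite E1 E2 /dlin cplxE cplxE /cder /= e2 -e1; split; ring.
Qed.

End Hol.

(** * Complex-valued functions and curves *)

Section ComplexContinuity.
Context {R : realType} {X : topologicalType}.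
Local Notation C := (complex R).
Local Notation Re := (@complex.Re R).
Local Notation Im := (@complex.Im R).
Implicit Types (u v : X -> C) (x : X).

Definition ccont x u :=
  {for x, continuous (Re \o u)} /\ {for x, continuous (Im \o u)}.

Lemma ccont_cst (c : C) x : ccont x (fun=> c).
Proof. by split; apply: cst_continuous. Qed.

Lemma ccontD u v x : ccont x u -> ccont x v -> ccont x (fun y => u y + v y).
Proof.
move=> [u1 u2] [v1 v2]; split.
  rewrite (_ : (Re \o (fun y => u y + v y)) = (Re \o u) + (Re \o v)).
    exact: continuousD u1 v1.
  by apply/funext => y; rewrite /= cReD.
rewrite (_ : (Im \o (fun y => u y + v y)) = (Im \o u) + (Im \o v)).
  exact: continuousD u2 v2.
by apply/funext => y; rewrite /= cImD.
Qed.

Lemma ccontM u v x : ccont x u -> ccont x v -> ccont x (fun y => u y * v y).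
Proof.
move=> [u1 u2] [v1 v2]; split.
  rewrite (_ : (Re \o (fun y => u y * v y)) =
      (Re \o u) * (Re \o v) - (Im \o u) * (Im \o v)).
    exact: continuousB (continuousM u1 v1) (continuousM u2 v2).
  by apply/funext => y; rewrite /= cReM.
rewrite (_ : (Im \o (fun y => u y * v y)) =
    (Re \o u) * (Im \o v) + (Im \o u) * (Re \o v)).
  exact: continuousD (continuousM u1 v2) (continuousM u2 v1).
by apply/funext => y; rewrite /= cImM.
Qed.

Lemma ccontN u x : ccont x u -> ccont x (fun y => - u y).
Proof.
move=> cu; have := ccontM (ccont_cst (-1) x) cu.
by under eq_fun do rewrite mulN1r.
Qed.

Lemma ccontB u v x : ccont x u -> ccont x v -> ccont x (fun y => u y - v y).
Proof. by move=> cu cv; apply: ccontD cu (ccontN cv). Qed.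

Lemma ccontV u x : u x != 0 -> ccont x u -> ccont x (fun y => (u y)^-1).
Proof.
move=> ux [u1 u2].
set N : X -> R := (Re \o u) * (Re \o u) + (Im \o u) * (Im \o u).
have N0 : N x != 0 by exact: sqmod_neq0.
have cN : {for x, continuous N}.
  exact: continuousD (continuousM u1 u1) (continuousM u2 u2).
have cV := continuousV N0 cN.
split.
  rewrite (_ : (Re \o (fun y => (u y)^-1)) = (Re \o u) * (fun y => (N y)^-1)).
    exact: continuousM u1 cV.
  by apply/funext => y; rewrite /= cReV.
rewrite (_ : (Im \o (fun y => (u y)^-1)) = - ((Im \o u) * (fun y => (N y)^-1))).
  exact: continuousN (continuousM u2 cV).
by apply/funext => y; rewrite /= cImV.
Qed.

End ComplexContinuity.

Section ComplexCurves.
Context {R : realType}.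
Local Notation C := (complex R).
Local Notation Re := (@complex.Re R).
Local Notation Im := (@complex.Im R).
Implicit Types (c e : R -> C) (t : R).

Definition cderiv c t (d : C) :=
  is_derive t 1 (Re \o c) (Re d) /\ is_derive t 1 (Im \o c) (Im d).

Lemma cderiv_cst (a : C) t : cderiv (fun=> a) t 0.
Proof. by split; apply: is_derive_cst. Qed.

Lemma cderivD c e t d d' : cderiv c t d -> cderiv e t d' ->
  cderiv (fun s => c s + e s) t (d + d').
Proof.
move=> [c1 c2] [e1 e2]; split; rewrite cplxE.
  rewrite (_ : (Re \o (fun s => c s + e s)) = (Re \o c) + (Re \o e)).
    exact: is_deriveD c1 e1.
  by apply/funext => s; rewrite /= cReD.
rewrite (_ : (Im \o (fun s => c s + e s)) = (Im \o c) + (Im \o e)).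
  exact: is_deriveD c2 e2.
by apply/funext => s; rewrite /= cImD.
Qed.

Lemma cderivM c e t d d' : cderiv c t d -> cderiv e t d' ->
  cderiv (fun s => c s * e s) t (c t * d' + e t * d).
Proof.
move=> [c1 c2] [e1 e2]; split.
  rewrite (_ : (Re \o (fun s => c s * e s)) =
    (Re \o c) * (Re \o e) - (Im \o c) * (Im \o e)).
    apply: is_derive_eq (is_deriveB (is_deriveM c1 e1) (is_deriveM c2 e2)) _.
    rewrite /= !cplxE /GRing.scale /=; ring.
  by apply/funext => s; rewrite /= cReM.
rewrite (_ : (Im \o (fun s => c s * e s)) =
    (Re \o c) * (Im \o e) + (Im \o c) * (Re \o e)).
  apply: is_derive_eq (is_deriveD (is_deriveM c1 e2) (is_deriveM c2 e1)) _.
  rewrite /= !cplxE /GRing.scale /=; ring.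
by apply/funext => s; rewrite /= cImM.
Qed.

Lemma cderivN c t d : cderiv c t d -> cderiv (fun s => - c s) t (- d).
Proof.
move=> cd; have := cderivM (cderiv_cst (-1) t) cd.
rewrite mulr0 addr0 mulN1r.
by under eq_fun do rewrite mulN1r.
Qed.

Lemma cderivB c e t d d' : cderiv c t d -> cderiv e t d' ->
  cderiv (fun s => c s - e s) t (d - d').
Proof. by move=> cd ed; apply: cderivD cd (cderivN ed). Qed.

Lemma cderivZ (a : C) c t d : cderiv c t d -> cderiv (fun s => a * c s) t (a * d).
Proof.
by move=> cd; have := cderivM (cderiv_cst a t) cd; rewrite mulr0 addr0.
Qed.

Lemma cderivV c t d : c t != 0 -> cderiv c t d ->
  cderiv (fun s => (c s)^-1) t (- ((c t)^-1 ^+ 2 * d)).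
Proof.
move=> ct [c1 c2].
set N : R -> R := (Re \o c) * (Re \o c) + (Im \o c) * (Im \o c).
have N0 : N t != 0 by exact: sqmod_neq0.
have cN := is_deriveD (is_deriveM c1 c1) (is_deriveM c2 c2).
have cV := is_deriveV N0 cN.
have NE : N t = Re (c t) * Re (c t) + Im (c t) * Im (c t) by [].
split.
  rewrite (_ : (Re \o (fun y => (c y)^-1)) = (Re \o c) * (fun y => (N y)^-1)).
    apply: is_derive_eq (is_deriveM c1 cV) _.
    rewrite /= !(cplxE, cReV, cImV) /GRing.scale /= NE; move: N0; rewrite NE.
    by move=> N0; field.
  by apply/funext => y; rewrite /= cReV.
rewrite (_ : (Im \o (fun y => (c y)^-1)) = - ((Im \o c) * (fun y => (N y)^-1))).
  apply: is_derive_eq (is_deriveN (is_deriveM c2 cV)) _.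
  rewrite /= !(cplxE, cReV, cImV) /GRing.scale /= NE; move: N0; rewrite NE.
  by move=> N0; field.
by apply/funext => y; rewrite /= cImV.
Qed.

Lemma is_derive_curve (f : R * R -> R) (x y : R -> R) t dx dy :
  differentiable f (x t, y t) -> is_derive t 1 x dx -> is_derive t 1 y dy ->
  is_derive t 1 (fun s => f (x s, y s)) ('d f (x t, y t) (dx, dy)).
Proof.
move=> df [Dx <-] [Dy <-].
have dx1 : differentiable x t by exact/derivable1_diffP.
have dy1 : differentiable y t by exact/derivable1_diffP.
have dxy := differentiable_pair dx1 dy1.
have dc : differentiable (f \o (fun s => (x s, y s))) t.
  exact: differentiable_comp.
split; first exact: diff_derivable.
rewrite (deriveE _ dc) (diff_comp dxy df) /= (diff_pair dx1 dy1) /=.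
by rewrite !deriveE.
Qed.

Definition uncplx (z : C) : R * R := (Re z, Im z).

(** Chain rule along a curve: by the Cauchy-Riemann equations the differential
of [u] is multiplication by [cder u]. *)
Lemma hol_curve (u : R * R -> C) c t d :
  hol u (uncplx (c t)) -> cderiv c t d ->
  cderiv (fun s => u (uncplx (c s))) t (cder u (uncplx (c t)) * d).
Proof.
move=> /hol_differentiable[d1 d2 dE] [c1 c2].
have [E1 E2] := dE (Re d, Im d).
have -> : d = cplx (Re d, Im d) by case: (d).
split.
- by rewrite -E1; exact: (is_derive_curve d1 c1 c2).
- by rewrite -E2; exact: (is_derive_curve d2 c1 c2).
Qed.

End ComplexCurves.

(** * Integrals over the circle *)

Section CircleIntegral.
Context {R : realType}.
Local Notation C := (complex R).
Local Notation Re := (@complex.Re R).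
Local Notation Im := (@complex.Im R).
Local Notation mu := (@lebesgue_measure R).
Local Notation T := (@pi R *+ 2).

Definition circint (f : R -> R) : R := \int[mu]_(x in `[0, T]) f x.

Lemma period_gt0 : 0 < T.
Proof. by rewrite mulrn_wgt0// pi_gt0. Qed.

Lemma circint_integrable (f : R -> R) : continuous f -> mu.-integrable `[0, T] (EFin \o f).
Proof.
move=> cf; apply: continuous_compact_integrable; first exact: segment_compact.
exact: continuous_subspaceT.
Qed.

Lemma circintD (f g : R -> R) : continuous f -> continuous g -> circint (f + g) = circint f + circint g.
Proof. by move=> cf cg; rewrite /circint RintegralD//; exact: circint_integrable. Qed.

Lemma circintZ (a : R) (f : R -> R) : continuous f -> circint (fun x => a * f x) = a * circint f.
Proof. by move=> cf; rewrite /circint RintegralZl//; exact: circint_integrable. Qed.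

Lemma circint_cst a : circint (fun=> a) = a * T.
Proof.
by rewrite /circint Rintegral_cst//= lebesgue_measure_itv/= lte_fin period_gt0/= subr0.
Qed.

Lemma circint_bound (f : R -> R) M : continuous f -> (forall x, `|f x| <= M) -> `|circint f| <= M * T.
Proof.
move=> cf fM; apply: le_trans (le_normr_Rintegral _ (circint_integrable cf)) _ => //.
rewrite -circint_cst; apply: le_Rintegral => //.
- apply: circint_integrable => x; apply: continuous_comp (cf x) _.
  exact: norm_continuous.
- by apply: circint_integrable => x; apply: cst_continuous.
Qed.

Lemma circint_FTC (f b : R -> R) : continuous f ->
  (forall x : R, is_derive x 1 b (f x)) -> circint f = b T - b 0.
Proof.
move=> cf db; rewrite /circint /Rintegral (@continuous_FTC2 _ f b _ _ period_gt0).
- by [].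
- exact: continuous_subspaceT.
- have cb x : {for x, continuous b}.
    by have [d _] := db x; apply/differentiable_continuous/derivable1_diffP.
  split; first by move=> x _; have [] := db x.
    exact: cvg_at_right_filter (cb 0).
  exact: cvg_at_left_filter (cb T).
- by move=> x _; rewrite derive1E; have [_ ->] := db x.
Qed.

(** Differentiation under the integral sign turns the [t]-derivative of the
integral into the increment of the periodic function [b t] over a period,
which is zero. The open interval around the unit interval makes the integral
differentiable up to the end points. *)
Lemma circint_homotopy (f f' b : R -> R -> R) (M : R) :
  (forall t : R, -1 < t < 2 -> continuous (f t)) ->
  (forall t : R, -1 < t < 2 -> continuous (f' t)) ->
  (forall t x : R, -1 < t < 2 -> is_derive t 1 (f ^~ x) (f' t x)) ->
  (forall t x : R, -1 < t < 2 -> `|f' t x| <= M) ->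
  (forall t x : R, 0 < t < 1 -> is_derive x 1 (b t) (f' t x)) ->
  (forall t : R, 0 < t < 1 -> b t 0 = b t T) ->
  circint (f 0) = circint (f 1).
Proof.
move=> cf cf' df M' db b0.
have tI (t : R) : (`]-1, 2[%classic : set R) t = (-1 < t < 2) :> Prop.
  by rewrite /= in_itv.
have pE (t x : R) : -1 < t < 2 -> partial1of2 f t x = f' t x.
  by move=> tI'; rewrite /partial1of2 derive1E; have [_ ->] := df t x tI'.
have intf (t : R) : (`]-1, 2[%classic : set R) t -> mu.-integrable `[0, T] (EFin \o f t).
  by rewrite tI => h; apply/circint_integrable/cf.
have derf (t x : R) : (`]-1, 2[%classic : set R) t -> `[0, T]%classic x ->
    derivable (f ^~ x) t 1.
  by rewrite tI => h _; have [] := df t x h.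
have M0 : 0 <= M.
  by apply: le_trans (M' 0 0 _); rewrite ?normr_ge0// ltr0n ltrN10.
have intG : mu.-integrable `[0, T] (EFin \o (fun=> M)).
  by apply: circint_integrable => x; apply: cst_continuous.
have GM (t x : R) : (`]-1, 2[%classic : set R) t -> `[0, T]%classic x ->
    `|partial1of2 f t x| <= M.
  by rewrite tI => h _; rewrite pE//; apply: M'.
have mI : measurable (`[0, T]%classic : set R) by [].
have D (t : R) : -1 < t < 2 -> is_derive t 1 (fun t => circint (f t)) (circint (f' t)).
  move=> h; have h' : (`]-1, 2[%classic : set R) t by rewrite tI.
  split.
    exact: (@derivable_under_integral R _ (measurableTypeR R) mu f _ mI t (-1) 2
      h' intf derf _ (fun=> M0) intG GM).
  rewrite -derive1E.
  rewrite (@differentiation_under_integral R _ (measurableTypeR R) mu f _ mI t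
    (-1) 2 h' intf derf _ (fun=> M0) intG GM).
  by apply: eq_Rintegral => x _; rewrite pE.
have [||c] := @MVT _ (fun t => circint (f t)) (fun t => circint (f' t)) 0 1 ltr01.
- move=> t; rewrite in_itv/= => /andP[t0 t1]; apply: D.
  by apply/andP; split; lra.
- apply: derivable_within_continuous => t; rewrite in_itv/= => /andP[t0 t1].
  by have [] : is_derive t 1 (fun t => circint (f t)) (circint (f' t)) by apply: D; lra.
rewrite in_itv/= => c01.
have cI : -1 < c < 2 by move/andP: c01 => [? ?]; lra.
have dbc (x : R) : is_derive x 1 (b c) (f' c x) by exact: db.
rewrite (circint_FTC (cf' _ cI) dbc).
by rewrite b0// subrr mul0r => /eqP; rewrite subr_eq0 => /eqP.
Qed.

Definition ccircint (f : R -> C) : C := (circint (Re \o f) +i* circint (Im \o f))%C.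

Definition ccont_all (f : R -> C) := forall x, ccont x f.

Lemma Re_ccircint f : Re (ccircint f) = circint (Re \o f). Proof. by []. Qed.
Lemma Im_ccircint f : Im (ccircint f) = circint (Im \o f). Proof. by []. Qed.

Lemma ccont_Re f : ccont_all f -> continuous (Re \o f).
Proof. by move=> cf x; have [] := cf x. Qed.
Lemma ccont_Im f : ccont_all f -> continuous (Im \o f).
Proof. by move=> cf x; have [] := cf x. Qed.

Lemma ccircintD f g : ccont_all f -> ccont_all g ->
  ccircint (fun x => f x + g x) = ccircint f + ccircint g.
Proof.
move=> cf cg; apply: complex_eq; rewrite ?cplxE.
  rewrite !Re_ccircint -(circintD (ccont_Re cf) (ccont_Re cg)); congr circint.
  by apply/funext => x; rewrite /= cReD.
rewrite !Im_ccircint -(circintD (ccont_Im cf) (ccont_Im cg)); congr circint.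
by apply/funext => x; rewrite /= cImD.
Qed.

Lemma ccircintZ a f : ccont_all f -> ccircint (fun x => a * f x) = a * ccircint f.
Proof.
move=> cf; have cR := ccont_Re cf; have cI := ccont_Im cf.
have cZ k (h : R -> R) : continuous h -> continuous (fun x => k * h x).
  by move=> ch x; apply: cvgM (ch x); apply: cvg_cst.
apply: complex_eq; rewrite ?cplxE.
  rewrite !Re_ccircint !Im_ccircint -(circintZ _ cR) -mulNr -(circintZ _ cI) -circintD; try exact: cZ.
  by congr circint; apply/funext => x; rewrite !fctE /= cReM mulNr.
rewrite !Re_ccircint !Im_ccircint -(circintZ _ cR) -(circintZ _ cI) -circintD; try exact: cZ.
by congr circint; apply/funext => x; rewrite !fctE /= cImM.
Qed.

Lemma ccircint_cst a : ccircint (fun=> a) = a * (T%:C)%C.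
Proof.
by apply: complex_eq; rewrite ?cplxE ?Re_ccircint ?Im_ccircint /comp circint_cst /= mulr0 ?subr0 ?add0r.
Qed.

Lemma normc_ReIm (z : C) : `|Re z| <= Normc.normc z /\ `|Im z| <= Normc.normc z.
Proof.
case: z => a b; rewrite /Normc.normc /=.
by rewrite -!sqrtr_sqr !ler_wsqrtr// ?lerDl ?lerDr sqr_ge0.
Qed.

Lemma normc_leD (z : C) : Normc.normc z <= `|Re z| + `|Im z|.
Proof.
case: z => a b; rewrite /Normc.normc /=.
rewrite -[leRHS]ger0_norm ?addr_ge0// -sqrtr_sqr ler_wsqrtr//.
rewrite sqrrD !real_normK ?num_real//.
by rewrite -addrA [X in _ <= _ + X]addrC addrA lerDl mulrn_wge0// mulr_ge0.
Qed.

Lemma ccircint_bound f M : ccont_all f -> (forall x, Normc.normc (f x) <= M) ->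
  Normc.normc (ccircint f) <= M * T *+ 2.
Proof.
move=> cf fM; apply: le_trans (normc_leD _) _; rewrite mulr2n; apply: lerD.
- apply: circint_bound; first exact: ccont_Re.
  by move=> x; apply: le_trans (fM x); have [] := normc_ReIm (f x).
- apply: circint_bound; first exact: ccont_Im.
  by move=> x; apply: le_trans (fM x); have [] := normc_ReIm (f x).
Qed.

End CircleIntegral.

(** * Cauchy's formula *)

Section Cauchy.
Context {R : realType}.
Local Notation C := (complex R).
Local Notation Re := (@complex.Re R).
Local Notation Im := (@complex.Im R).
Local Notation T := (@pi R *+ 2).
Local Notation N := (@Normc.normc R).
Implicit Types (u v : R * R -> C) (p q : R * R) (z w : C).

Lemma normc_ge0 z : 0 <= N z.
Proof. by case: z => a b; rewrite /Normc.normc sqrtr_ge0. Qed.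

Lemma normcD z w : N (z + w) <= N z + N w.
Proof. exact: (@le_normcD R z w). Qed.

Lemma normcB z w : N z - N w <= N (z - w).
Proof. by rewrite lerBlDr -{1}(subrK w z); apply: normcD. Qed.

Lemma normc_opp z : N (- z) = N z.
Proof. by case: z => a b; rewrite /Normc.normc /= !sqrrN. Qed.

Lemma normc_real (t : R) : N (t%:C)%C = `|t|.
Proof. by rewrite /Normc.normc /= expr0n addr0 sqrtr_sqr. Qed.

Lemma normc_gt0 z : 0 < N z -> z != 0.
Proof. by apply: contraTneq => ->; rewrite Normc.normc0 ltxx. Qed.

Lemma ccircint_homotopy (F F' B : R -> R -> C) (M : R) :
  (forall t : R, -1 < t < 2 -> ccont_all (F t)) ->
  (forall t : R, -1 < t < 2 -> ccont_all (F' t)) ->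
  (forall t x : R, -1 < t < 2 -> cderiv (F ^~ x) t (F' t x)) ->
  (forall t x : R, -1 < t < 2 -> N (F' t x) <= M) ->
  (forall t x : R, 0 < t < 1 -> cderiv (B t) x (F' t x)) ->
  (forall t : R, 0 < t < 1 -> B t 0 = B t T) ->
  ccircint (F 0) = ccircint (F 1).
Proof.
move=> cF cF' dF bF dB B0; apply: complex_eq.
- apply: (@circint_homotopy _ (fun t x => Re (F t x)) (fun t x => Re (F' t x))
    (fun t x => Re (B t x)) M).
  + by move=> t tI; apply: ccont_Re (cF t tI).
  + by move=> t tI; apply: ccont_Re (cF' t tI).
  + by move=> t x tI; have [] := dF t x tI.
  + by move=> t x tI; apply: le_trans (bF t x tI); have [] := normc_ReIm (F' t x).
  + by move=> t x tI; have [] := dB t x tI.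
  + by move=> t tI; rewrite B0.
- apply: (@circint_homotopy _ (fun t x => Im (F t x)) (fun t x => Im (F' t x))
    (fun t x => Im (B t x)) M).
  + by move=> t tI; apply: ccont_Im (cF t tI).
  + by move=> t tI; apply: ccont_Im (cF' t tI).
  + by move=> t x tI; have [] := dF t x tI.
  + by move=> t x tI; apply: le_trans (bF t x tI); have [] := normc_ReIm (F' t x).
  + by move=> t x tI; have [] := dB t x tI.
  + by move=> t tI; rewrite B0.
Qed.

Lemma cderiv_eq (c : R -> C) t d d' : cderiv c t d -> d = d' -> cderiv c t d'.
Proof. by move=> ? <-. Qed.

Definition circle (r x : R) : C := (r * cos x +i* (r * sin x))%C.

Lemma normc_circle r x : 0 <= r -> N (circle r x) = r.
Proof.
move=> r0; rewrite /Normc.normc /= !exprMn -mulrDr cos2Dsin2 mulr1.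
by rewrite sqrtr_sqr ger0_norm.
Qed.

Lemma cderiv_circle r x : cderiv (circle r) x ('i%C * circle r x).
Proof.
split.
  rewrite (_ : Re \o _ = r \*: @cos R); last by apply/funext.
  apply: is_derive_eq (is_deriveZ _ (is_derive_cos x)) _.
  by rewrite /GRing.scale /=; ring.
rewrite (_ : Im \o _ = r \*: @sin R); last by apply/funext.
apply: is_derive_eq (is_deriveZ _ (is_derive_sin x)) _.
by rewrite /GRing.scale /=; ring.
Qed.

Lemma cderiv_ccont (c : R -> C) t d : cderiv c t d -> ccont t c.
Proof.
by move=> [[d1 _] [d2 _]]; split;
  apply/differentiable_continuous/derivable1_diffP.
Qed.

Lemma ccont_circle r : ccont_all (circle r).
Proof. by move=> x; apply: cderiv_ccont (cderiv_circle r x). Qed.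

Lemma circle_periodic r : circle r 0 = circle r T.
Proof. by rewrite /circle cos0 sin0 cos2pi sin2pi. Qed.

Lemma circle_sub_ge (r x : R) z d : 0 <= r -> N z <= r - d -> d <= N (circle r x - z).
Proof.
move=> r0 zd; apply: le_trans (normcB _ _); rewrite normc_circle//.
by rewrite lerBrDl -lerBrDr.
Qed.

Lemma circle_sub_neq0 (r x : R) z : 0 <= r -> N z < r -> circle r x - z != 0.
Proof.
move=> r0 zr; apply: normc_gt0.
by apply: lt_le_trans (@circle_sub_ge r x z (r - N z) r0 _); lra.
Qed.

(** The index of the circle around a point inside it: the point is moved to
the centre along [t * w], and the [t]-derivative of [z / (z - t * w)], which is
[z * w / (z - t * w) ^ 2], is the derivative of ['i * w / (z - t * w)] along the
circle. *)
Lemma ccircint_index (r : R) w : 0 < r -> N w <= r / 4 ->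
  ccircint (fun x => circle r x * (circle r x - w)^-1) = (T%:C)%C.
Proof.
move=> r0 wr; have r0' := ltW r0.
(* The moving point [t * w] keeps the distance [r / 2] from the circle. *)
have tw (t : R) : -1 < t < 2 -> N (t%:C%C * w) <= r - r / 2.
  move=> /andP[t1 t2]; rewrite Normc.normcM normc_real.
  have t2' : `|t| <= 2 by rewrite ler_norml; apply/andP; split; lra.
  have := ler_pM (normr_ge0 t) (normc_ge0 w) t2' wr; lra.
have tn0 (t x : R) : -1 < t < 2 -> circle r x - t%:C%C * w != 0.
  by move=> tI; apply: circle_sub_neq0 => //; have := tw t tI; lra.
have ck (t : R) : -1 < t < 2 -> ccont_all (fun x => (circle r x - t%:C%C * w)^-1).
  move=> tI x; apply: ccontV; first exact: tn0.
  exact: ccontB (ccont_circle r x) (ccont_cst _ x).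
have dline (x t : R) : cderiv (fun t : R => circle r x - t%:C%C * w) t (- w).
  have di : cderiv (fun t : R => t%:C%C : C) t 1.
    by split; [exact: is_derive_id|exact: is_derive_cst].
  apply: cderiv_eq (cderivB (cderiv_cst (circle r x) t)
    (cderivM di (cderiv_cst w t))) _.
  by ring.
have := @ccircint_homotopy (fun t x => circle r x * (circle r x - t%:C%C * w)^-1)
  (fun t x => circle r x * (w * (circle r x - t%:C%C * w)^-1 ^+ 2))
  (fun t x => 'i%C * w * (circle r x - t%:C%C * w)^-1)
  (r * (r / 4 * (r / 2)^-1 ^+ 2)) _ _ _ _ _ _.
have -> : (fun x => circle r x * (circle r x - (0 : R)%:C%C * w)^-1) = fun=> 1.
  apply/funext => x; rewrite mul0r subr0 divff//.
  by apply: normc_gt0; rewrite normc_circle.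
rewrite ccircint_cst mul1r.
have -> : (fun x => circle r x * (circle r x - (1 : R)%:C%C * w)^-1) =
  (fun x => circle r x * (circle r x - w)^-1).
  by apply/funext => x; rewrite mul1r.
move=> <-; first by [].
- by move=> t tI x; apply: ccontM (ccont_circle r x) (ck t tI x).
- move=> t tI x; apply: ccontM (ccont_circle r x) _.
  apply: ccontM (ccont_cst _ x) _.
  exact: ccontM (ck t tI x) (ck t tI x).
- move=> t x tI; apply: cderivZ.
  apply: cderiv_eq (cderivV (tn0 t x tI) (dline x t)) _.
  by rewrite mulrN opprK mulrC.
- move=> t x tI; rewrite !(Normc.normcM, Normc.normcV) normc_circle//.
  have l := circle_sub_ge x r0' (tw t tI).
  rewrite ler_wpM2l//; apply: ler_pM => //; first exact: normc_ge0.
    by rewrite mulr_ge0 ?invr_ge0 ?normc_ge0.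
  have r20 : 0 < r / 2 by rewrite divr_gt0.
  have l' : (N (circle r x - t%:C%C * w))^-1 <= (r / 2)^-1.
    by rewrite lef_pV2// posrE; apply: lt_le_trans l.
  by rewrite expr2; apply: ler_pM; rewrite ?invr_ge0 ?normc_ge0.
- move=> t x t01; have tI : -1 < t < 2 by move: t01 => /andP[? ?]; lra.
  have dB := cderivB (cderiv_circle r x) (cderiv_cst (t%:C%C * w) x).
  apply: cderiv_eq (cderivZ ('i%C * w) (cderivV (tn0 t x tI) dB)) _.
  have ii : 'i%C * 'i%C = -1 :> C by rewrite -expr2 sqr_i.
  rewrite subr0; set c := circle r x; set d := (_)^-1 ^+ 2.
  rewrite (_ : _ * _ = - ('i%C * 'i%C) * (c * (w * d))); last by ring.
  by rewrite ii opprK mul1r.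
- by move=> t _; rewrite circle_periodic.
Qed.

End Cauchy.

Section CauchyFormula.
Context {R : realType}.
Local Notation C := (complex R).
Local Notation Re := (@complex.Re R).
Local Notation Im := (@complex.Im R).
Local Notation T := (@pi R *+ 2).
Local Notation N := (@Normc.normc R).
Implicit Types (u v : R * R -> C) (p q : R * R) (z w : C).

Lemma ccont_comp_uncplx u (c : R -> C) x :
  ccont (uncplx (c x)) u -> ccont x c -> ccont x (fun y => u (uncplx (c y))).
Proof.
move=> [u1 u2] [c1 c2].
have cp : {for x, continuous (fun y => uncplx (c y))} by exact: cvg_pair c1 c2.
by split; [apply: (continuous_comp cp u1)|apply: (continuous_comp cp u2)].
Qed.

Lemma hol_ccont u p : hol u p -> ccont p u.
Proof.
by move=> [u1 u2 _]; split; [exact: C1at_continuous u1|exact: C1at_continuous u2].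
Qed.

Lemma hol_ccont_cder u p : hol u p -> ccont p (cder u).
Proof. by move=> [[_ u1 _] [_ u2 _] _]; split. Qed.

(** The circle is shrunk to the point [w] by [w + t * (z - w)]. This leaves the
kernel [z / (z - w)] fixed, and the [t]-derivative of the integrand, [u'] times
[z], is the derivative of [u / (t * 'i)] along the shrunk circle. At [t = 0] only
the index of the circle remains. *)
Lemma cauchy_formula u z0 (r M : R) w : 0 < r ->
  (forall z, N (z - z0) < 4 * r -> hol u (uncplx z)) ->
  (forall z, N (z - z0) < 4 * r -> N (cder u (uncplx z)) <= M) ->
  N w <= r / 4 ->
  ccircint (fun x => u (uncplx (z0 + circle r x)) * (circle r x * (circle r x - w)^-1)) =
  u (uncplx (z0 + w)) * (T%:C)%C.
Proof.
move=> r0 hu bu wr; have r0' := ltW r0.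
set K := fun x => circle r x * (circle r x - w)^-1.
have n0 x : circle r x - w != 0.
  by apply: circle_sub_neq0 => //; lra.
have cK : ccont_all K.
  move=> x; apply: ccontM (ccont_circle r x) _; apply: ccontV (n0 x) _.
  exact: ccontB (ccont_circle r x) (ccont_cst _ x).
pose g (t x : R) : C := z0 + w + t%:C%C * (circle r x - w).
(* For [t] in the open interval the deformed circle has points
   [(1 - t) w + t z] from the centre, of modulus at most [2 (r / 4) + 2 r]. *)
have gb t x : -1 < t < 2 -> N (g t x - z0) < 4 * r.
  move=> /andP[t1 t2].
  have -> : g t x - z0 = (1 - t)%:C%C * w + t%:C%C * circle r x.
    by rewrite /g rmorphB rmorph1; ring.
  apply: le_lt_trans (normcD _ _) _.
  rewrite !Normc.normcM !normc_real normc_circle//.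
  have t2' : `|t| <= 2 by rewrite ler_norml; apply/andP; split; lra.
  have t1' : `|1 - t| <= 2 by rewrite ler_norml; apply/andP; split; lra.
  have := ler_pM (normr_ge0 _) (normc_ge0 w) t1' wr.
  have := ler_wpM2r r0' t2'; lra.
have dgt t x : cderiv (g ^~ x) t (circle r x - w).
  have di : cderiv (fun t : R => t%:C%C : C) t 1.
    by split; [exact: is_derive_id|exact: is_derive_cst].
  apply: cderiv_eq (cderivD (cderiv_cst (z0 + w) t)
    (cderivM di (cderiv_cst (circle r x - w) t))) _.
  by ring.
have dgx t x : cderiv (g t) x (t%:C%C * ('i%C * circle r x)).
  apply: cderiv_eq (cderivD (cderiv_cst (z0 + w) x) (cderivZ t%:C%C
    (cderivB (cderiv_circle r x) (cderiv_cst w x)))) _.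
  by ring.
have cg t : ccont_all (g t) by move=> x; apply: cderiv_ccont (dgx t x).
rewrite -(ccircint_index r0 wr) -ccircintZ//.
have := @ccircint_homotopy _ (fun t x => u (uncplx (g t x)) * K x)
  (fun t x => cder u (uncplx (g t x)) * circle r x)
  (fun t x => (t%:C%C * 'i%C)^-1 * u (uncplx (g t x))) (M * r) _ _ _ _ _ _.
have -> : (fun x => u (uncplx (g 0 x)) * K x) = (fun x => u (uncplx (z0 + w)) * K x).
  by apply/funext => x; rewrite /g mul0r addr0.
have -> : (fun x => u (uncplx (g 1 x)) * K x) =
    (fun x => u (uncplx (z0 + circle r x)) * K x).
  by apply/funext => x; rewrite /g mul1r -addrA [w + _]addrC subrK.
move=> <-; first by [].
- move=> t tI x; apply: ccontM (cK x).
  exact: (@ccont_comp_uncplx u (g t) x (hol_ccont (hu _ (gb t x tI))) (cg t x)).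
- move=> t tI x; apply: ccontM (ccont_circle r x).
  exact: (@ccont_comp_uncplx (cder u) (g t) x (hol_ccont_cder (hu _ (gb t x tI))) (cg t x)).
- move=> t x tI.
  have := cderivZ (K x) (@hol_curve _ u (g ^~ x) t _ (hu _ (gb t x tI)) (dgt t x)).
  under eq_fun do rewrite mulrC.
  move/cderiv_eq; apply; rewrite /K; field; exact: n0.
- move=> t x tI; rewrite Normc.normcM normc_circle// ler_wpM2r//.
  exact/bu/gb.
- move=> t x t01; have tI : -1 < t < 2 by move: t01 => /andP[? ?]; lra.
  apply: cderiv_eq (cderivZ _ (@hol_curve _ u (g t) x _ (hu _ (gb t x tI)) (dgx t x))) _.
  have t0 : t%:C%C != 0 :> C.
    by rewrite fmorph_eq0; move: t01 => /andP[/gt_eqF->].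
  have i0 : 'i%C != 0 :> C by rewrite eq_complex /= oner_eq0 andbF.
  field; by rewrite t0 i0.
- by move=> t _; rewrite /g circle_periodic.
Qed.

End CauchyFormula.

(** * Removable singularities *)

Section Division.
Context {R : realType}.
Local Notation C := (complex R).
Local Notation Re := (@complex.Re R).
Local Notation Im := (@complex.Im R).
Local Notation T := (@pi R *+ 2).
Local Notation N := (@Normc.normc R).
Implicit Types (u v : R * R -> C) (p q : R * R) (z w h : C) (m : R -> C).

Lemma normc_prod_le p : N (cplx p) <= `|p.1| + `|p.2|.
Proof. exact: normc_leD. Qed.

Lemma near_normc p (d : R) : 0 < d -> \forall q \near p, N (cplx q - cplx p) < d.
Proof.
move=> d0; have d2 : 0 < d / 2 by rewrite divr_gt0.
apply/nbhs_ballP; exists (d / 2) => //= -[q1 q2] [/= b1 b2].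
case: p b1 b2 => p1 p2; rewrite /ball /= distrC => b1; rewrite distrC => b2.
apply: le_lt_trans (@normc_prod_le (q1 - p1, q2 - p2)) _ => /=; lra.
Qed.

Lemma nbhs_normc p (P : set (R * R)) : (\forall q \near p, P q) ->
  exists2 d : R, 0 < d & forall q, N (cplx q - cplx p) < d -> P q.
Proof.
move=> /nbhs_ballP[d /= d0 dP]; exists d => // -[q1 q2].
case: p dP => p1 p2 dP qd; apply: dP.
have [h1 h2] := normc_ReIm (cplx (q1, q2) - cplx (p1, p2)).
split; rewrite /ball /= distrC; first by apply: le_lt_trans h1 qd.
by apply: le_lt_trans h2 qd.
Qed.

Lemma ccont_lipschitz p u (K d : R) : 0 < d ->
  (forall q, N (cplx q - cplx p) < d -> N (u q - u p) <= K * N (cplx q - cplx p)) ->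
  ccont p u.
Proof.
move=> d0 uK.
have K1 : 0 < `|K| + 1 by apply: ltr_wpDl.
have H e : 0 < e -> \forall q \near p, N (u p - u q) < e.
  move=> e0; have b0 : 0 < Num.min d (e / (`|K| + 1)).
    by rewrite lt_min d0 divr_gt0.
  apply: filterS (near_normc p b0) => q; rewrite lt_min => /andP[qd qe].
  rewrite -normc_opp opprB; apply: le_lt_trans (uK _ qd) _.
  apply: (@le_lt_trans _ _ ((`|K| + 1) * N (cplx q - cplx p))).
    apply: ler_wpM2r; first exact: normc_ge0.
    by rewrite (le_trans (ler_norm _))// lerDl.
  by rewrite mulrC -ltr_pdivlMr.
split; apply/cvgrPdist_lt => e e0; apply: filterS (H e e0) => q; apply: le_lt_trans.
  by have [+ _] := normc_ReIm (u p - u q); rewrite cReD cReN.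
by have [_ +] := normc_ReIm (u p - u q); rewrite cImD cImN.
Qed.

(** A quadratic error bound is what the resolvent identities below provide; it
is stronger than the little-o estimate that defines a derivative. *)
Lemma is_derive_quadratic (f : R * R -> R) p (v : R * R) (a K d : R) : 0 < d ->
  (forall s : R, `|s| < d -> `|f (s *: v + p) - f p - s * a| <= K * `|s| ^+ 2) ->
  is_derive p v f a.
Proof.
move=> d0 fK.
have K1 : 0 < `|K| + 1 by apply: ltr_wpDl.
have H : s^-1 *: (f (s *: v + p) - f p) @[s --> 0^'] --> a.
  apply/cvgrPdist_lt => e e0; have b0 : 0 < Num.min d (e / (`|K| + 1)).
    by rewrite lt_min d0 divr_gt0.
  exists (Num.min d (e / (`|K| + 1))) => //= s; rewrite /ball /= sub0r normrN.
  rewrite lt_min => /andP[sd se] s0.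
  have sn0 : 0 < `|s| by rewrite normr_gt0.
  have -> : a - s^-1 *: (f (s *: v + p) - f p) =
      - (s^-1 * (f (s *: v + p) - f p - s * a)).
    rewrite /GRing.scale /=; move: (f _ - f p) => D; field; exact: s0.
  rewrite normrN normrM normfV ltr_pdivrMl//.
  apply: le_lt_trans (fK s sd) _.
  rewrite expr2 mulrA mulrC ltr_pM2l//.
  apply: (@le_lt_trans _ _ ((`|K| + 1) * `|s|)).
    by apply: ler_wpM2r => //; rewrite (le_trans (ler_norm _))// lerDl.
  by rewrite mulrC -ltr_pdivlMr.
split; first by apply/cvg_ex; exists a.
exact: cvg_lim H.
Qed.

(** Complex differentiability at the points near [p], with a derivative that is
continuous at [p], gives both the regularity and the Cauchy-Riemann equations. *)
Lemma hol_intro u u' p :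
  (\forall q \near p, exists K d : R, 0 < d /\ forall h : R * R, N (cplx h) < d ->
     N (u (h + q) - u q - cplx h * u' q) <= K * N (cplx h) ^+ 2) ->
  ccont p u' -> hol u p.
Proof.
move=> uK cu'.
have H q : (exists K d : R, 0 < d /\ forall h : R * R, N (cplx h) < d ->
     N (u (h + q) - u q - cplx h * u' q) <= K * N (cplx h) ^+ 2) ->
    [/\ is_derive q (1, 0) (Re \o u) (Re (u' q)),
        is_derive q (1, 0) (Im \o u) (Im (u' q)),
        is_derive q (0, 1) (Re \o u) (- Im (u' q)) &
        is_derive q (0, 1) (Im \o u) (Re (u' q))].
  move=> [K [d [d0 uKd]]].
  have N1 (s : R) : N (cplx (s *: (1, 0))) = `|s|.
    by rewrite pairZE mulr1 mulr0 /cplx /= expr0n addr0 sqrtr_sqr.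
  have N2 (s : R) : N (cplx (s *: (0, 1))) = `|s|.
    by rewrite pairZE mulr1 mulr0 /cplx /= expr0n add0r sqrtr_sqr.
  split; apply: (@is_derive_quadratic _ _ _ _ K d d0) => s sd.
  - have := uKd (s *: (1, 0)); rewrite N1 => /(_ sd); apply: le_trans.
    have [+ _] := normc_ReIm (u (s *: (1, 0) + q) - u q - cplx (s *: (1, 0)) * u' q).
    by rewrite !cplxE pairZE /cplx /= mulr1 mulr0 mul0r subr0.
  - have := uKd (s *: (1, 0)); rewrite N1 => /(_ sd); apply: le_trans.
    have [_ +] := normc_ReIm (u (s *: (1, 0) + q) - u q - cplx (s *: (1, 0)) * u' q).
    by rewrite !cplxE pairZE /cplx /= mulr1 mulr0 mul0r addr0.
  - have := uKd (s *: (0, 1)); rewrite N2 => /(_ sd); apply: le_trans.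
    have [+ _] := normc_ReIm (u (s *: (0, 1) + q) - u q - cplx (s *: (0, 1)) * u' q).
    by rewrite !cplxE pairZE /cplx /= mulr1 mulr0 mul0r sub0r mulrN.
  - have := uKd (s *: (0, 1)); rewrite N2 => /(_ sd); apply: le_trans.
    have [_ +] := normc_ReIm (u (s *: (0, 1) + q) - u q - cplx (s *: (0, 1)) * u' q).
    by rewrite !cplxE pairZE /cplx /= mulr1 mulr0 mul0r add0r.
have [h1 h2 h3 h4] := H p (nbhs_singleton uK).
split.
- apply: (@C1at_intro _ _ (Re \o u') (fun q => - Im (u' q))).
  + by apply: filterS uK => q /H[].
  + by case: cu'.
  + by case: cu' => _ c2; apply: continuousN c2.
- apply: (@C1at_intro _ _ (Im \o u') (Re \o u')).
  + by apply: filterS uK => q /H[].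
  + by case: cu'.
  + by case: cu'.
- split.
    by rewrite (@derive_val _ _ _ _ _ _ _ h1) (@derive_val _ _ _ _ _ _ _ h4).
  by rewrite (@derive_val _ _ _ _ _ _ _ h2) (@derive_val _ _ _ _ _ _ _ h3).
Qed.

(** The exponent [k] is there for the derivatives: up to a factor the [k]-th
transform is the [k - 1]-st derivative of the first one. *)
Definition cauchy_transform (r : R) m (k : nat) w : C :=
  ccircint (fun x => m x * (circle r x - w)^-1 ^+ k).

Lemma circle_kernel (r : R) w x : 0 < r -> N w <= r / 2 ->
  circle r x - w != 0 /\ N (circle r x - w)^-1 <= 2 / r.
Proof.
move=> r0 wr; have r20 : 0 < r / 2 by rewrite divr_gt0.
have h : r / 2 <= N (circle r x - w).
  by apply: (circle_sub_ge x (ltW r0)); lra.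
split; first by apply: normc_gt0; apply: lt_le_trans h.
by rewrite Normc.normcV -[2 / r]invf_div lef_pV2 ?posrE//; apply: lt_le_trans h.
Qed.

Lemma ccont_kernel (r : R) m w k : 0 < r -> N w <= r / 2 -> ccont_all m ->
  ccont_all (fun x => m x * (circle r x - w)^-1 ^+ k).
Proof.
move=> r0 wr cm x; apply: ccontM (cm x) _.
have [n0 _] := circle_kernel x r0 wr.
have ck : ccont x (fun y => (circle r y - w)^-1).
  by apply: ccontV n0 _; apply: ccontB (ccont_circle r x) (ccont_cst _ x).
elim: k => [|k IH]; first exact: ccont_cst.
by under eq_fun do rewrite exprS; apply: ccontM.
Qed.

Lemma normcX z k : N (z ^+ k) = N z ^+ k.
Proof.
by elim: k => [|k IH]; rewrite ?expr0 ?Normc.normc1// !exprS Normc.normcM IH.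
Qed.

(** The error of the linear approximation is exactly [h ^ 2] times the integral
of [m / ((z - w) ^ 2 * (z - w - h))], and all factors [z - w] have modulus at
least [r / 2]. *)
Lemma cauchy_transform_quadratic (r M : R) m w h : 0 < r -> ccont_all m ->
  (forall x, N (m x) <= M) -> N w <= r / 4 -> N h <= r / 4 ->
  N (cauchy_transform r m 1 (w + h) - cauchy_transform r m 1 w - h * cauchy_transform r m 2 w) <=
  (M * (2 / r) ^+ 3) * T *+ 2 * N h ^+ 2.
Proof.
move=> r0 cm mM wr hr.
have wr2 : N w <= r / 2 by lra.
have whr : N (w + h) <= r / 2 by apply: le_trans (normcD _ _) _; lra.
pose D x := m x * ((circle r x - w)^-1 ^+ 2 * (circle r x - (w + h))^-1).
have cD : ccont_all D.
  move=> x; apply: ccontM (cm x) _.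
  have := ccontM (ccont_kernel 2 r0 wr2 (fun x => ccont_cst 1 x) x)
    (ccont_kernel 1 r0 whr (fun x => ccont_cst 1 x) x).
  by under eq_fun do rewrite !mul1r expr1.
have c1 := ccont_kernel 1 r0 wr2 cm.
have c2 := ccont_kernel 2 r0 wr2 cm.
have cZ (a : C) f : ccont_all f -> ccont_all (fun x => a * f x).
  by move=> cf x; apply: ccontM (ccont_cst a x) (cf x).
have -> : cauchy_transform r m 1 (w + h) =
    cauchy_transform r m 1 w + (h * cauchy_transform r m 2 w + h ^+ 2 * ccircint D).
  rewrite -!ccircintZ// -ccircintD; try exact: cZ.
  rewrite -ccircintD//; last by move=> x; apply: ccontD; apply: cZ.
  congr ccircint; apply/funext => x; rewrite /D !expr1.
  have [n1 _] := circle_kernel x r0 wr2; have [n2 _] := circle_kernel x r0 whr.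
  by field; rewrite n1 n2.
rewrite (_ : _ - _ - _ = h ^+ 2 * ccircint D); last by ring.
rewrite Normc.normcM normcX mulrC; apply: ler_wpM2r; first by rewrite exprn_ge0 ?normc_ge0.
apply: ccircint_bound => // x; rewrite /D !(Normc.normcM, normcX).
have [_ b1] := circle_kernel x r0 wr2; have [_ b2] := circle_kernel x r0 whr.
apply: ler_pM => //; rewrite ?mulr_ge0 ?exprn_ge0 ?normc_ge0//.
have [a0 e0] := (normc_ge0 (circle r x - w)^-1, normc_ge0 (circle r x - (w + h))^-1).
rewrite exprSr expr2; apply: ler_pM => //; first exact: mulr_ge0.
exact: ler_pM.
Qed.

Lemma cauchy_transform2_lipschitz (r M : R) m w h : 0 < r -> ccont_all m ->
  (forall x, N (m x) <= M) -> N w <= r / 4 -> N h <= r / 4 ->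
  N (cauchy_transform r m 2 (w + h) - cauchy_transform r m 2 w) <=
  (M * (4 * r * (2 / r) ^+ 4)) * T *+ 2 * N h.
Proof.
move=> r0 cm mM wr hr.
have wr2 : N w <= r / 2 by lra.
have whr : N (w + h) <= r / 2 by apply: le_trans (normcD _ _) _; lra.
pose D x := m x * ((circle r x - w + (circle r x - (w + h))) *
  ((circle r x - w)^-1 ^+ 2 * (circle r x - (w + h))^-1 ^+ 2)).
have cD : ccont_all D.
  move=> x; apply: ccontM (cm x) _; apply: ccontM.
    by apply: ccontD; apply: ccontB (ccont_circle r x) (ccont_cst _ x).
  have := ccontM (ccont_kernel 2 r0 wr2 (fun x => ccont_cst 1 x) x)
    (ccont_kernel 2 r0 whr (fun x => ccont_cst 1 x) x).
  by under eq_fun do rewrite !mul1r.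
have c2 := ccont_kernel 2 r0 wr2 cm.
have -> : cauchy_transform r m 2 (w + h) = cauchy_transform r m 2 w + h * ccircint D.
  rewrite -ccircintZ// -ccircintD//; last first.
    by move=> x; apply: ccontM (ccont_cst h x) (cD x).
  congr ccircint; apply/funext => x; rewrite /D.
  have [n1 _] := circle_kernel x r0 wr2; have [n2 _] := circle_kernel x r0 whr.
  by field; rewrite n1 n2.
rewrite addrC addKr Normc.normcM mulrC; apply: ler_wpM2r; first exact: normc_ge0.
apply: ccircint_bound => // x; rewrite /D !(Normc.normcM, normcX).
have [_ b1] := circle_kernel x r0 wr2; have [_ b2] := circle_kernel x r0 whr.
have b r' : N r' <= r / 2 -> N (circle r x - r') <= 2 * r.
  move=> r'r; apply: le_trans (normcD _ _) _.
  by rewrite normc_opp normc_circle ?ltW//; lra.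
apply: ler_pM => //; rewrite ?mulr_ge0 ?exprn_ge0 ?normc_ge0//.
apply: ler_pM; rewrite ?mulr_ge0 ?exprn_ge0 ?normc_ge0//.
  apply: le_trans (normcD _ _) _.
  by have := b _ wr2; have := b _ whr; lra.
have [a0 e0] := (normc_ge0 (circle r x - w)^-1, normc_ge0 (circle r x - (w + h))^-1).
by rewrite (_ : 4%N = (2 + 2)%N)// exprD expr2; apply: ler_pM;
  rewrite ?mulr_ge0// ler_pM.
Qed.

Lemma hol_cauchy_transform (r M : R) m z0 p : 0 < r -> ccont_all m ->
  (forall x, N (m x) <= M) -> N (cplx p - z0) < r / 4 ->
  hol (fun q => cauchy_transform r m 1 (cplx q - z0)) p.
Proof.
move=> r0 cm mM pr.
have r40 : 0 < r / 4 by rewrite divr_gt0.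
have zcD q q' : cplx (q + q') = cplx q + cplx q' by [].
apply: (@hol_intro _ (fun q => cauchy_transform r m 2 (cplx q - z0))).
- have d0 : 0 < r / 4 - N (cplx p - z0) by rewrite subr_gt0.
  apply: filterS (near_normc p d0) => q qd.
  have qr : N (cplx q - z0) <= r / 4.
    rewrite -(subrK (cplx p) (cplx q)) -addrA.
    by apply: le_trans (normcD _ _) _; lra.
  exists ((M * (2 / r) ^+ 3) * T *+ 2), (r / 4); split => // h hr.
  have := cauchy_transform_quadratic r0 cm mM qr (ltW hr).
  by rewrite zcD (_ : cplx q - z0 + cplx h = cplx h + cplx q - z0); last by ring.
- apply: (@ccont_lipschitz _ _ ((M * (4 * r * (2 / r) ^+ 4)) * T *+ 2) (r / 4)) => //.
  move=> q qr; have := cauchy_transform2_lipschitz r0 cm mM (ltW pr) (ltW qr).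
  by rewrite (_ : cplx p - z0 + (cplx q - cplx p) = cplx q - z0); last by ring.
Qed.

(** The removable singularity theorem. On a small circle around [p],
[z / (z - w) - 1 = w / (z - w)]; hence subtracting Cauchy's formula at the centre,
where [u] vanishes, from the formula at [p + w] exhibits [u (p + w) / w] as a
Cauchy transform of [u], which is holomorphic at [w = 0] as well. *)
Lemma hol_division u p : (\forall q \near p, hol u q) -> u p = 0 ->
  exists Q, \forall q \near p, hol Q q /\ u q = (cplx q - cplx p) * Q q.
Proof.
move=> hu up0.
have hup := nbhs_singleton hu.
have bnd v : ccont p v -> \forall q \near p, N (v q) <= N (v p) + 2.
  move=> [v1 v2].
  move/cvgrPdist_lt : v1 => /(_ _ ltr01) v1.
  move/cvgrPdist_lt : v2 => /(_ _ ltr01) v2.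
  apply: filterS2 v1 v2 => q v1 v2.
  rewrite -lerBlDl; apply: le_trans (normcB _ _) _.
  apply: le_trans (normc_leD _) _; rewrite !cplxE.
  by rewrite distrC in v1; rewrite distrC in v2; move: v1 v2 => /=; lra.
set M1 := N (u p) + 2; set M2 := N (cder u p) + 2.
have [d d0 H] := nbhs_normc (filterI hu
  (filterI (bnd _ (hol_ccont hup)) (bnd _ (hol_ccont_cder hup)))).
(* On the disk of radius [4 r] around [p], [u] is holomorphic and bounded with
   its derivative. *)
pose r := d / 4.
have r0 : 0 < r by rewrite divr_gt0.
pose z0 := cplx p.
have zpc z : cplx (uncplx z) = z by case: z.
have pzc q : uncplx (cplx q) = q by case: q.
have r4 : 4 * r = d by rewrite /r; field.
have Hz z : N (z - z0) < 4 * r ->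
    [/\ hol u (uncplx z), N (cder u (uncplx z)) <= M2 & N (u (uncplx z)) <= M1].
  rewrite r4 => zr; have /H : N (cplx (uncplx z) - cplx p) < d by rewrite zpc.
  by move=> [? []].
have h1 z : N (z - z0) < 4 * r -> hol u (uncplx z) by move=> /Hz[].
have h2 z : N (z - z0) < 4 * r -> N (cder u (uncplx z)) <= M2 by move=> /Hz[].
have h3 z : N (z - z0) < 4 * r -> N (u (uncplx z)) <= M1 by move=> /Hz[].
pose m x := u (uncplx (z0 + circle r x)).
have inb x : N (z0 + circle r x - z0) < 4 * r.
  by rewrite addrC addKr normc_circle ?ltW//; lra.
have cm : ccont_all m.
  move=> x; apply: (@ccont_comp_uncplx _ u (fun x => z0 + circle r x)).
    exact/hol_ccont/h1.
  exact: ccontD (ccont_cst z0 x) (ccont_circle r x).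
have mM x : N (m x) <= M1 by exact: h3.
exists (fun q => (T%:C)%C^-1 * cauchy_transform r m 1 (cplx q - z0)).
have r40 : 0 < r / 4 by rewrite divr_gt0.
apply: filterS (near_normc p r40) => q qr; split.
  exact: holM (hol_cst _ q) (hol_cauchy_transform r0 cm mM qr).
set w := cplx q - z0.
have wr2 : N w <= r / 2 by move: qr; rewrite -/z0 -/w; lra.
have T0 : (T%:C)%C != 0 :> C by rewrite fmorph_eq0 gt_eqF// period_gt0.
have F1 := cauchy_formula r0 h1 h2 (ltW qr).
have zr0 : N (0 : C) <= r / 4 by rewrite Normc.normc0 ltW.
have F0 := cauchy_formula r0 h1 h2 zr0.
rewrite addr0 pzc up0 mul0r in F0.
have F1' : u q = (T%:C)%C^-1 * ccircint (fun x => m x * (circle r x * (circle r x - w)^-1)).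
  by rewrite F1 [z0 + _]addrC subrK pzc mulrC mulfK.
have E : ccircint (fun x => m x * (circle r x * (circle r x - w)^-1)) =
    ccircint (fun x => m x * (circle r x * (circle r x - 0)^-1)) + w * cauchy_transform r m 1 w.
  have c1 := ccont_kernel 1 r0 wr2 cm.
  rewrite -ccircintZ// -ccircintD.
  - congr ccircint; apply/funext => x; rewrite subr0 expr1.
    have [n1 _] := circle_kernel x r0 wr2.
    have n2 : circle r x != 0 by apply: normc_gt0; rewrite normc_circle ?ltW.
    by rewrite -/(m x); field; rewrite n1 n2.
  - move=> x; apply: ccontM (cm x) _; apply: ccontM (ccont_circle r x) _.
    apply: ccontV; last exact: ccontB (ccont_circle r x) (ccont_cst _ x).
    by rewrite subr0; apply: normc_gt0; rewrite normc_circle ?ltW.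
  - by move=> x; apply: ccontM (ccont_cst w x) (c1 x).
by rewrite F1' E -/m F0 add0r mulrCA.
Qed.

End Division.

(** * The complex exponential series *)

Section ComplexExponential.
Context {R : realType}.
Local Notation C := (complex R).
Local Notation Re := (@complex.Re R).
Local Notation Im := (@complex.Im R).
Local Notation N := (@Normc.normc R).
Implicit Types (z w a h : C) (u v : nat -> C).

Lemma cReZ (c : R) z : Re (c%:C%C * z) = c * Re z.
Proof. by rewrite cReM /= mul0r subr0. Qed.

Definition ccvg u (l : C) :=
  (fun n => Re (u n)) @ \oo --> Re l /\ (fun n => Im (u n)) @ \oo --> Im l.

Lemma ccvg_eq u v l : ccvg u l -> (forall n, u n = v n) -> ccvg v l.
Proof. by move=> cu uv; rewrite (_ : v = u)//; apply/funext. Qed.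

Lemma ccvg_uniq u l l' : ccvg u l -> ccvg u l' -> l = l'.
Proof.
by move=> [a b] [c d]; apply: complex_eq; [exact: (cvg_unique _ a c)|
  exact: (cvg_unique _ b d)].
Qed.

Lemma ccvgD u v l l' : ccvg u l -> ccvg v l' -> ccvg (fun n => u n + v n) (l + l').
Proof.
move=> [a b] [c d]; split; rewrite cplxE.
  by under eq_fun do rewrite cReD; apply: cvgD.
by under eq_fun do rewrite cImD; apply: cvgD.
Qed.

Lemma ccvgZ z u l : ccvg u l -> ccvg (fun n => z * u n) (z * l).
Proof.
move=> [c d]; split; rewrite cplxE.
  by under eq_fun do rewrite cReM; apply: cvgB; apply: cvgM => //; apply: cvg_cst.
by under eq_fun do rewrite cImM; apply: cvgD; apply: cvgM => //; apply: cvg_cst.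
Qed.

Definition cexp z : C :=
  (expR (Re z) * cos (Im z) +i* (expR (Re z) * sin (Im z)))%C.

Lemma cexpD z w : cexp (z + w) = cexp z * cexp w.
Proof.
by apply: complex_eq; rewrite !cplxE /cexp /= cReD cImD expRD ?cosD ?sinD; ring.
Qed.

Lemma cexp0 : cexp 0 = 1.
Proof. by rewrite /cexp /= expR0 cos0 sin0 mulr1 mulr0. Qed.

Lemma cexp_neq0 z : cexp z != 0.
Proof.
apply/eqP => z0; have := cexpD z (- z); rewrite subrr cexp0 z0 mul0r.
by move/eqP; rewrite oner_eq0.
Qed.

Lemma cderiv_cexp z (t : R) :
  cderiv (fun t => cexp (t%:C%C * z)) t (z * cexp (t%:C%C * z)).
Proof.
case: z => x y.
have E (s : R) : cexp (s%:C%C * ((x +i* y)%C : C)) =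
    (expR (x * s) * cos (y * s) +i* (expR (x * s) * sin (y * s)))%C.
  by rewrite /cexp /= !mul0r subr0 addr0 ![s * _]mulrC.
have dl (c s : R) : is_derive s 1 (fun s : R => c * s) c.
  by apply: is_derive_eq (is_deriveZ c (is_derive_id s 1)) _; rewrite [_ *: _]mulr1.
have d1 : is_derive t 1 (fun s => expR (x * s)) (x * expR (x * t)).
  have := @is_derive1_comp _ expR (fun s => x * s) t _ _ (is_derive_expR _) (dl x t).
  by rewrite mulrC.
have d2 : is_derive t 1 (fun s => cos (y * s)) (- y * sin (y * t)).
  have := @is_derive1_comp _ cos (fun s => y * s) t _ _ (is_derive_cos _) (dl y t).
  by rewrite mulrC mulrN mulNr.
have d3 : is_derive t 1 (fun s => sin (y * s)) (y * cos (y * t)).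
  have := @is_derive1_comp _ sin (fun s => y * s) t _ _ (is_derive_sin _) (dl y t).
  by rewrite mulrC.
split.
  rewrite (_ : _ \o _ = (fun s => expR (x * s)) * (fun s => cos (y * s))).
    apply: is_derive_eq (is_deriveM d1 d2) _.
    by rewrite E cReM /GRing.scale /=; ring.
  by apply/funext => s; exact: (congr1 Re (E s)).
rewrite (_ : _ \o _ = (fun s => expR (x * s)) * (fun s => sin (y * s))).
  apply: is_derive_eq (is_deriveM d1 d3) _.
  by rewrite E cImM /GRing.scale /=; ring.
by apply/funext => s; exact: (congr1 Im (E s)).
Qed.

(** Coefficients of the power series of the real part of [w * exp (t * z)] in
[t]. The weight [w] makes the family closed under differentiation, which only
multiplies [w] by [z]. *)
Definition exp_coef w z (n : nat) : R := Re (w * z ^+ n) * (n`!%:R)^-1.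

Lemma exp_coef_cvg w z (t : R) : cvgn (pseries (exp_coef w z) t).
Proof.
apply: normed_cvg.
apply: (@series_le_cvg _ _ (fun n => N w * exp_coeff (N z * `|t|) n)).
- by move=> n; rewrite normr_ge0.
- by move=> n; rewrite mulr_ge0 ?normc_ge0// exp_coeff_ge0// mulr_ge0// normc_ge0.
- move=> n; rewrite /exp_coef /exp_coeff /= normrM normrX.
  rewrite normrM (@ger0_norm _ (n`!%:R)^-1) ?invr_ge0//.
  rewrite exprMn mulrAC mulrA ler_wpM2r ?invr_ge0//.
  rewrite mulrA; apply: ler_wpM2r; first by rewrite exprn_ge0.
  have [+ _] := normc_ReIm (w * z ^+ n).
  by rewrite Normc.normcM normcX.
- have := @is_cvg_series_exp_coeff R (N z * `|t|) => /cvg_ex[l hl].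
  apply/cvg_ex; exists (N w * l).
  rewrite (_ : series _ = (fun n => N w * series (exp_coeff (N z * `|t|)) n)).
    by apply: cvgM hl; apply: cvg_cst.
  by apply/funext => n; rewrite /series /= mulr_sumr.
Qed.

Lemma exp_coef_diffs w z : pseries_diffs (exp_coef w z) = exp_coef (w * z) z.
Proof.
apply/funext => i; rewrite /pseries_diffs /exp_coef factS natrM invfM exprS [w * (_ * _)]mulrA.
have i0 : i.+1%:R != 0 :> R by rewrite pnatr_eq0.
by rewrite mulrCA [i.+1%:R * _]mulrA mulfV// mul1r.
Qed.

Definition exp_part w z (t : R) : R := limn (pseries (exp_coef w z) t).

Lemma is_derive_exp_part w z (t : R) :
  is_derive t 1 (exp_part w z) (exp_part (w * z) z t).
Proof.
rewrite /exp_part -exp_coef_diffs.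
apply: (@pseries_snd_diffs _ _ (`|t| + 1)).
- exact: exp_coef_cvg.
- by rewrite exp_coef_diffs; apply: exp_coef_cvg.
- by rewrite !exp_coef_diffs; apply: exp_coef_cvg.
- by rewrite [ltRHS]ger0_norm// ltrDl.
Qed.

Lemma exp_partE (x y : R) w w' w'' z t :
  (forall c, Re (w * c) = x * Re (w' * c) + y * Re (w'' * c)) ->
  exp_part w z t = x * exp_part w' z t + y * exp_part w'' z t.
Proof.
move=> E; apply/cvg_lim => //.
have -> : pseries (exp_coef w z) t =
    (fun n => x * pseries (exp_coef w' z) t n + y * pseries (exp_coef w'' z) t n).
  apply/funext => n; rewrite /pseries /series /= !mulr_sumr -big_split /=.
  by apply: eq_bigr => i _; rewrite /exp_coef E; ring.
by apply: cvgD; apply: cvgM; try exact: cvg_cst; exact: exp_coef_cvg.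
Qed.

(** The power series of the complex exponential and its closed form solve the
same linear differential equation along the segment from [0] to [z]. *)
Lemma cexp_series z :
  ccvg (fun n => \sum_(0 <= k < n) ((k`!%:R)^-1)%:C%C * z ^+ k) (cexp z).
Proof.
(* The weight [- 'i] turns the real part into the imaginary part. *)
pose P (t : R) : C := (exp_part 1 z t +i* exp_part (- 'i%C) z t)%C.
have dP t : cderiv P t (z * P t).
  split.
    apply: is_derive_eq (is_derive_exp_part 1 z t) _.
    rewrite (@exp_partE (Re z) (- Im z) _ 1 (- 'i%C)).
      by rewrite cReM /=; ring.
    by move=> c; rewrite !cplxE /=; ring.
  apply: is_derive_eq (is_derive_exp_part (- 'i%C) z t) _.
  rewrite (@exp_partE (Im z) (Re z) _ 1 (- 'i%C)).
    by rewrite cImM /=; ring.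
  by move=> c; rewrite !cplxE /=; ring.
pose E (t : R) := cexp (t%:C%C * z).
(* Both [P] and [E] solve [y' = z y], so their quotient is constant. *)
have dQ t : cderiv (fun t => P t * (E t)^-1) t 0.
  have E0 : E t != 0 := cexp_neq0 _.
  apply: cderiv_eq (cderivM (dP t) (cderivV E0 (cderiv_cexp z t))) _.
  by rewrite -/(E t); field.
have cst01 : P 1 * (E 1)^-1 = P 0 * (E 0)^-1.
  apply: complex_eq.
    by apply: (@is_derive_0_is_cst _ (Re \o (fun t => P t * (E t)^-1)) 1 0) => t;
      have [] := dQ t.
  by apply: (@is_derive_0_is_cst _ (Im \o (fun t => P t * (E t)^-1)) 1 0) => t;
      have [] := dQ t.
have part0 w : exp_part w z 0 = Re w.
  apply/cvg_lim => //; rewrite -cvg_shiftS; apply: cvg_near_cst; apply: nearW => n.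
  rewrite /pseries /series /= big_nat_recl// expr0 mulr1 big1 ?addr0.
    by rewrite /exp_coef expr0 fact0 invr1 !mulr1.
  by move=> i _; rewrite expr0n mulr0.
have P0 : P 0 = 1.
  by apply: complex_eq; rewrite /P /= part0 /= ?oppr0.
have E00 : E 0 = 1 by rewrite /E mul0r cexp0.
have P1 : P 1 = cexp z.
  have E1 : E 1 = cexp z by rewrite /E mul1r.
  move: cst01; rewrite P0 E00 E1 invr1 mulr1 => h.
  by rewrite -[LHS](mulfVK (cexp_neq0 z)) h mul1r.
have cw w : (fun n => Re (w * \sum_(0 <= k < n) ((k`!%:R)^-1)%:C%C * z ^+ k)) @ \oo
    --> exp_part w z 1.
  rewrite (_ : (fun _ => _) = pseries (exp_coef w z) 1); first exact: exp_coef_cvg.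
  apply/funext => n; rewrite /pseries /series /=.
  elim: n => [|n IH]; first by rewrite !big_nil mulr0.
  rewrite !big_nat_recr//= mulrDr cReD IH; congr (_ + _).
  by rewrite mulrCA cReZ /exp_coef expr1n mulr1 mulrC.
split; rewrite -P1 /P /=.
  by have := cw 1; under eq_fun do rewrite mul1r.
have := cw (- 'i%C); under eq_fun do rewrite cReM /= oppr0 mul0r sub0r mulN1r opprK.
by [].
Qed.

(** [p n] and [r n] are the scalar and the vector coefficient of the [n]-th power
of [a + v], where [v] squares to [- h]. After a square root [s] of [- h] is
adjoined they are the half sum and the divided half difference of the powers of
[a + s] and [a - s]. For [s = 0] the binomial formula stops after the linear
term in [v]. *)
Lemma exp_scalar_vector a h (p r : nat -> C) :
  p 0 = 1 -> r 0 = 0 ->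
  (forall n, p n.+1 = a * p n - h * r n) ->
  (forall n, r n.+1 = a * r n + p n) ->
  exists P rho, [/\
    ccvg (fun n => \sum_(0 <= k < n) ((k`!%:R)^-1)%:C%C * p k) P,
    ccvg (fun n => \sum_(0 <= k < n) ((k`!%:R)^-1)%:C%C * r k) rho,
    P ^+ 2 + h * rho ^+ 2 = cexp a ^+ 2 & h = 0 -> P = cexp a].
Proof.
move=> p0 r0 pS rS.
pose s := sqrtc (- h).
have s2 : h = - s ^+ 2 by rewrite sqr_sqrtc opprK.
have [s0|s0] := eqVneq s 0.
  have h0 : h = 0 by rewrite s2 s0 expr0n oppr0.
  have pE n : p n = a ^+ n.
    by elim: n => [|n IH]; rewrite ?p0// pS IH h0 mul0r subr0 exprS.
  have rE n : r n.+1 = n.+1%:R * a ^+ n.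
    elim: n => [|n IH]; first by rewrite rS r0 mulr0 add0r p0 mul1r.
    by rewrite rS IH pE mulrCA -exprS -[n.+2%:R]natr1 mulrDl mul1r.
  exists (cexp a), (cexp a); split => //.
  - by apply: ccvg_eq (cexp_series a) _ => n; apply: eq_bigr => k _; rewrite pE.
  - have [c1 c2] := cexp_series a.
    have E n : \sum_(0 <= k < n.+1) ((k`!%:R)^-1)%:C%C * r k =
        \sum_(0 <= k < n) ((k`!%:R)^-1)%:C%C * a ^+ k.
      rewrite big_nat_recl// r0 mulr0 add0r; apply: eq_bigr => k _.
      have k0 : k.+1%:R != 0 :> C by rewrite pnatr_eq0.
      rewrite rE mulrA; congr (_ * _); rewrite factS natrM invfM rmorphM /=.
      by rewrite fmorphV rmorph_nat mulrAC mulVf ?mul1r.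
    split; rewrite -cvg_shiftS.
      by under eq_fun do rewrite E.
    by under eq_fun do rewrite E.
  - by rewrite h0 mul0r addr0.
have two0 : 2 != 0 :> C by rewrite pnatr_eq0.
have sum n : p n + s * r n = (a + s) ^+ n.
  elim: n => [|n IH]; first by rewrite p0 r0 mulr0 addr0.
  by rewrite exprS -IH pS rS s2; ring.
have dif n : p n - s * r n = (a - s) ^+ n.
  elim: n => [|n IH]; first by rewrite p0 r0 mulr0 subr0.
  by rewrite exprS -IH pS rS s2; ring.
have ca := cexp_series (a + s); have cb := cexp_series (a - s).
exists (2^-1 * (cexp (a + s) + cexp (a - s))).
exists ((2 * s)^-1 * (cexp (a + s) + -1 * cexp (a - s))); split.
- apply: ccvg_eq (ccvgZ 2^-1 (ccvgD ca cb)) _ => n.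
  rewrite -big_split mulr_sumr /=; apply: eq_bigr => k _.
  by rewrite -sum -dif; move: (_%:C)%C => c; field.
- apply: ccvg_eq (ccvgZ (2 * s)^-1 (ccvgD ca (ccvgZ (-1) cb))) _ => n.
  rewrite mulr_sumr -big_split mulr_sumr /=; apply: eq_bigr => k _.
  rewrite -sum -dif; move: (_%:C)%C => c; field; exact: s0.
- have <- : cexp (a + s) * cexp (a - s) = cexp a ^+ 2.
    by rewrite -cexpD expr2 -cexpD; congr cexp; ring.
  by rewrite s2; field; exact: s0.
- by move=> h0; move: s0; rewrite -sqrf_eq0 sqr_sqrtc h0 oppr0 eqxx.
Qed.

End ComplexExponential.

(** * Coordinates of stem functions *)

Section Stems.
Context {R : realType}.
Local Notation C := (complex R).
Local Notation Re := (@complex.Re R).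
Local Notation Im := (@complex.Im R).
Implicit Types (D : set (R * R)) (F : R * R -> quat R) (p : R * R) (l : 'I_4).

(** A stem function takes values in the complexified quaternions; [ccoord l] is
the [l]-th complex coordinate of the value [x + 'i y]. *)
Definition ccoord l (x y : quat R) : C := (x ord0 l +i* y ord0 l)%C.

Lemma C1_on_coord D F p l : open D -> C1_on D F -> D p ->
  C1at (fun q => F q ord0 l) p /\
  forall v : R * R, derivable F p v ->
    'D_v (fun q => F q ord0 l) p = ('D_v F p : quat R) ord0 l.
Proof.
move=> oD cF Dp.
have dE q (v : R * R) : derivable F q v ->
    is_derive q v (fun q => F q ord0 l) (('D_v F q : quat R) ord0 l).
  move=> dF; split; first exact: (proj1 (derivable_mxP F q v) dF ord0 l).
  by rewrite (derive_mx dF) mxE.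
split; last by move=> v /dE[].
have [_ _ c1 c2] := cF p Dp.
have Dn : \forall q \near p, D q by exact: open_nbhs_nbhs.
apply: (@C1at_intro _ _ (fun q => (d_alpha F q : quat R) ord0 l)
  (fun q => (d_beta F q : quat R) ord0 l)).
- apply: filterS Dn => q Dq; have [d1 d2 _ _] := cF q Dq.
  by split; exact: dE.
- apply: (@continuous_comp _ _ _ (d_alpha F) (fun M : quat R => M ord0 l) _ c1).
  exact: coord_continuous.
- apply: (@continuous_comp _ _ _ (d_beta F) (fun M : quat R => M ord0 l) _ c2).
  exact: coord_continuous.
Qed.

Lemma continuous_row (T : topologicalType) (F : T -> quat R) (x : T) :
  (forall l, {for x, continuous (fun y => F y ord0 l)}) -> {for x, continuous F}.
Proof.
move=> cF.
have -> : F = \sum_(l < 4) (fun y => (F y ord0 l) *: (delta_mx ord0 l : quat R)).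
  apply/funext => y; rewrite fct_sumE; exact: row_sum_delta.
elim/big_ind : _ => [|f g cf cg|l _].
- exact: cst_continuous.
- exact: continuousD cf cg.
- by apply: cvgZr_tmp; exact: cF.
Qed.

Lemma coord_C1_on D F : open D ->
  (forall p l, D p -> C1at (fun q => F q ord0 l) p) -> C1_on D F.
Proof.
move=> oD cF p Dp.
have Dn : \forall q \near p, D q by exact: open_nbhs_nbhs.
have d1 q : D q -> derivable F q (1, 0).
  move=> Dq; apply/derivable_mxP => i l; have -> : i = ord0 by exact: ord1.
  exact: (proj1 (C1at_derivable (cF q l Dq))).
have d2 q : D q -> derivable F q (0, 1).
  move=> Dq; apply/derivable_mxP => i l; have -> : i = ord0 by exact: ord1.
  exact: (proj2 (C1at_derivable (cF q l Dq))).
split; [exact: d1|exact: d2| |].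
- apply: continuous_row => l; have [_ c _] := cF p l Dp.
  apply: near_eq_continuous c; apply: filterS Dn => q Dq.
  by rewrite /d_alpha (derive_mx (d1 q Dq)) mxE.
- apply: continuous_row => l; have [_ _ c] := cF p l Dp.
  apply: near_eq_continuous c; apply: filterS Dn => q Dq.
  by rewrite /d_beta (derive_mx (d2 q Dq)) mxE.
Qed.

Lemma hol_stem D F0 F1 p l : open D -> holomorphic_stem D F0 F1 -> D p ->
  hol (fun q => ccoord l (F0 q) (F1 q)) p.
Proof.
move=> oD [c0 c1 _ cr] Dp.
have [h0 e0] := C1_on_coord l oD c0 Dp; have [h1 e1] := C1_on_coord l oD c1 Dp.
have [a0 b0 _ _] := c0 p Dp; have [a1 b1 _ _] := c1 p Dp.
have [r1 r2] := cr p Dp.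
split; [exact: h0|exact: h1|].
split.
  rewrite [LHS](e0 _ a0) [RHS](e1 _ b1).
  by move: r1; rewrite /d_alpha /d_beta => ->.
rewrite [LHS](e0 _ b0).
transitivity (- (('D_(1, 0) F1 p : quat R) ord0 l)); last by rewrite -(e1 _ a1).
by move: r2; rewrite /d_alpha /d_beta => ->; rewrite mxE.
Qed.

(** Converse of [hol_stem]: holomorphic coordinates with the symmetry of complex
conjugation assemble to a stem function. *)
Lemma stem_of_hol D (H : 'I_4 -> R * R -> C) : open D ->
  (forall p l, D p -> hol (H l) p) ->
  (forall p l, D p -> H l (p.1, - p.2) = ((H l p)^*)%C) ->
  holomorphic_stem D (fun p => \row_l Re (H l p)) (fun p => \row_l Im (H l p)).
Proof.
move=> oD hH sH.
have E0 l : (fun q => (\row_l Re (H l q)) ord0 l) = (Re \o H l).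
  by apply/funext => q; rewrite mxE.
have E1 l : (fun q => (\row_l Im (H l q)) ord0 l) = (Im \o H l).
  by apply/funext => q; rewrite mxE.
have c0 : C1_on D (fun p => \row_l Re (H l p) : quat R).
  by apply: coord_C1_on => // p l Dp; rewrite E0; case: (hH p l Dp).
have c1 : C1_on D (fun p => \row_l Im (H l p) : quat R).
  by apply: coord_C1_on => // p l Dp; rewrite E1; case: (hH p l Dp).
split => // p Dp.
  split; apply/rowP => l; rewrite !mxE sH//; by case: (H l p).
have [a0 b0 _ _] := c0 p Dp; have [a1 b1 _ _] := c1 p Dp.
rewrite /d_alpha /d_beta (derive_mx a0) (derive_mx b0) (derive_mx a1) (derive_mx b1).
split; apply/rowP => l; rewrite !mxE !E0 !E1; by case: (hH p l Dp) => _ _ [].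
Qed.

End Stems.

(** * Slices of the quaternions *)

Section Slices.
Context {R : realType}.
Local Notation C := (complex R).
Local Notation Re := (@complex.Re R).
Local Notation Im := (@complex.Im R).
Implicit Types (Omega : set (quat R)) (I x y q : quat R) (p : R * R).

Lemma reN x : re (- x) = - re x. Proof. by rewrite /re mxE. Qed.
Lemma imiN x : imi (- x) = - imi x. Proof. by rewrite /imi mxE. Qed.
Lemma imjN x : imj (- x) = - imj x. Proof. by rewrite /imj mxE. Qed.
Lemma imkN x : imk (- x) = - imk x. Proof. by rewrite /imk mxE. Qed.
Lemma re1 : re (1 : quat R) = 1. Proof. by rewrite qoneE quatE. Qed.
Lemma imi1 : imi (1 : quat R) = 0. Proof. by rewrite qoneE quatE. Qed.
Lemma imj1 : imj (1 : quat R) = 0. Proof. by rewrite qoneE quatE. Qed.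
Lemma imk1 : imk (1 : quat R) = 0. Proof. by rewrite qoneE quatE. Qed.
Lemma reM x y : re (x * y) =
  re x * re y - imi x * imi y - imj x * imj y - imk x * imk y.
Proof. by rewrite qmulE /qmul !quatE. Qed.
Lemma imiM x y : imi (x * y) =
  re x * imi y + imi x * re y + imj x * imk y - imk x * imj y.
Proof. by rewrite qmulE /qmul !quatE. Qed.
Lemma imjM x y : imj (x * y) =
  re x * imj y - imi x * imk y + imj x * re y + imk x * imi y.
Proof. by rewrite qmulE /qmul !quatE. Qed.
Lemma imkM x y : imk (x * y) =
  re x * imk y + imi x * imj y - imj x * imi y + imk x * re y.
Proof. by rewrite qmulE /qmul !quatE. Qed.
Definition qE := (reN, imiN, imjN, imkN, re1, imi1, imj1, imk1,
  reM, imiM, imjM, imkM, @quatE R).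

Lemma imag_unitsP I : imag_units I <->
  re I = 0 /\ imi I ^+ 2 + imj I ^+ 2 + imk I ^+ 2 = 1.
Proof.
split=> [II|[r0 n1]].
  have E (f : quat R -> R) : f (I * I) = f (-1) by rewrite -expr2 II.
  have := E re; have := E imi; have := E imj; have := E imk; rewrite !qE.
  move: (re I) (imi I) (imj I) (imk I) => a b c d ek ej ei er.
  have a0 : a = 0.
    apply/eqP; apply/negPn/negP => a0.
    have z (s : R) : a * s + s * a = 0 -> s = 0.
      move=> h; have : a * s = 0 by lra.
      by move/eqP; rewrite mulf_eq0 (negbTE a0) => /eqP.
    have b0 : b = 0 by apply: z; nra.
    have c0 : c = 0 by apply: z; nra.
    have d0 : d = 0 by apply: z; nra.
    by move: er; rewrite b0 c0 d0; have := sqr_ge0 a; nra.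
  by split => //; move: er; rewrite a0; nra.
rewrite /imag_units /= expr2; apply: quatP; rewrite !qE r0; try ring.
by rewrite -n1; ring.
Qed.

Lemma imag_units_qi : imag_units (qi : quat R).
Proof. by apply/imag_unitsP; rewrite !qE; split => //; ring. Qed.

Lemma imag_units_qj : imag_units (qj : quat R).
Proof. by apply/imag_unitsP; rewrite !qE; split => //; ring. Qed.

Lemma imag_unitsN I : imag_units I -> imag_units (- I).
Proof. by move=> II; rewrite /imag_units /= sqrrN. Qed.

Lemma slice_ptN I p : slice_pt (- I) p = slice_pt I (p.1, - p.2).
Proof. by rewrite /slice_pt /= scalerN scaleNr. Qed.

Lemma imag_unit_mul I : imag_units I -> I * I = -1.
Proof. by rewrite /imag_units /= -expr2. Qed.

Lemma slice_ptM I (z w : C) : imag_units I ->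
  slice_pt I (uncplx z) * slice_pt I (uncplx w) = slice_pt I (uncplx (z * w)).
Proof.
move=> /imag_unit_mul II; rewrite /slice_pt /= !cplxE.
rewrite mulrDl !mulrDr -!scalerAl -!scalerAr !mul1r mulr1 II !scalerA.
rewrite scalerN !scalerBl !scalerDl; move: (_ *: 1) (_ *: 1) (_ *: I) (_ *: I).
by move=> a b c d; rewrite [c - a]addrC addrACA.
Qed.

Lemma slice_ptX I (z : C) n : imag_units I ->
  slice_pt I (uncplx z) ^+ n = slice_pt I (uncplx (z ^+ n)).
Proof.
move=> hI; elim: n => [|n IH]; last by rewrite !exprS IH slice_ptM.
by rewrite !expr0 /slice_pt /= scale1r scale0r addr0.
Qed.

Lemma re_slice_pt I p : imag_units I -> re (slice_pt I p) = p.1.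
Proof. by move=> /imag_unitsP[r0 _]; rewrite /slice_pt !qE r0; ring. Qed.

Lemma qvec_slice_pt I p : imag_units I -> qvec (slice_pt I p) = p.2 *: I.
Proof.
move=> /imag_unitsP[r0 _]; apply: quatP; rewrite /qvec /slice_pt !qE ?r0; ring.
Qed.

Lemma qnorm_scale_unit I (b : R) : imag_units I -> qnorm (b *: I) = `|b|.
Proof.
move=> /imag_unitsP[r0 n1]; rewrite /qnorm /qnormsq !qE r0.
rewrite (_ : _ + _ = b ^+ 2 * (imi I ^+ 2 + imj I ^+ 2 + imk I ^+ 2)); last by ring.
by rewrite n1 mulr1 sqrtr_sqr.
Qed.

Lemma circular_slice Omega I J p : circular_domain Omega -> imag_units I ->
  imag_units J -> Omega (slice_pt I p) -> Omega (slice_pt J p).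
Proof.
move=> [_ _ _ circ] hI hJ OI.
have S K : imag_units K -> Omega (slice_pt K (p.1, `|p.2|)).
  move=> hK; apply: (circ _ OI); exists K => //.
  by rewrite re_slice_pt// qvec_slice_pt// qnorm_scale_unit.
have [p0|p0] := leP 0 p.2.
  by have := S J hJ; rewrite ger0_norm// -surjective_pairing.
have := S (- J) (imag_unitsN hJ).
by rewrite slice_ptN /= ltr0_norm// opprK -surjective_pairing.
Qed.

Lemma stem_domP Omega I p : circular_domain Omega -> imag_units I ->
  stem_dom Omega p <-> Omega (slice_pt I p).
Proof.
move=> hO hI; split=> [[J hJ OJ]|OI]; last by exists I.
exact: circular_slice hO hJ hI OJ.
Qed.

Lemma stem_dom_conj Omega p : circular_domain Omega -> stem_dom Omega p ->
  stem_dom Omega (p.1, - p.2).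
Proof.
move=> hO [I hI OI]; exists (- I); first exact: imag_unitsN.
by rewrite slice_ptN /= opprK -surjective_pairing.
Qed.

Lemma slice_pt_continuous I : continuous (slice_pt I).
Proof.
move=> p; apply: cvgD.
  by apply: cvgZr_tmp; exact: cvg_fst.
by apply: cvgZr_tmp; exact: cvg_snd.
Qed.

Lemma open_stem_dom Omega : circular_domain Omega -> open (stem_dom Omega).
Proof.
move=> hO; have [_ oO _ _] := hO.
have -> : stem_dom Omega = slice_pt qi @^-1` Omega.
  by apply/seteqP; split=> p /(stem_domP _ hO imag_units_qi).
apply: open_comp oO => p _; exact: slice_pt_continuous.
Qed.

(** For a real [q] any unit would do; [qi] is taken. *)
Lemma slice_ptE q : exists2 I, imag_units I & q = slice_pt I (re q, qnorm (qvec q)).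
Proof.
have n2 : qnorm (qvec q) ^+ 2 = imi q ^+ 2 + imj q ^+ 2 + imk q ^+ 2.
  rewrite /qnorm sqr_sqrtr; first by rewrite /qnormsq /qvec !qE; ring.
  by rewrite /qnormsq !addr_ge0 ?sqr_ge0.
have [n0|n0] := eqVneq (qnorm (qvec q)) 0.
  exists qi; first exact: imag_units_qi.
  have v0 : qvec q = 0.
    apply/eqP; rewrite -qnormsq_eq0; apply/eqP.
    have -> : qnormsq (qvec q) = qnorm (qvec q) ^+ 2.
      by rewrite n2 /qnormsq /qvec !qE; ring.
    by rewrite n0 expr0n.
  move: (v0); rewrite n0 /slice_pt /= scale0r addr0 => v0'.
  have E (f : quat R -> R) : f (qvec q) = f 0 by rewrite v0.
  have := E imi; have := E imj; have := E imk; rewrite /qvec !qE => ek ej ei.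
  by apply: quatP; rewrite !qE ?ek ?ej ?ei; ring.
exists ((qnorm (qvec q))^-1 *: qvec q).
  apply/imag_unitsP; rewrite /qvec !qE mulr0 !exprMn -!mulrDr -n2 -exprMn mulVf//.
  by rewrite expr1n.
apply: quatP; rewrite /slice_pt /qvec !qE ?mulr0 ?addr0 ?add0r ?mulr1 ?mulVKf//.
Qed.

End Slices.

(** * Star products and star exponentials on stems *)

Section StemAlgebra.
Context {R : realType}.
Local Notation C := (complex R).
Local Notation Re := (@complex.Re R).
Local Notation Im := (@complex.Im R).
Implicit Types (Omega : set (quat R)) (I x y q : quat R) (p : R * R) (l : 'I_4).
Implicit Types (f g : quat R -> quat R) (F G : R * R -> quat R).

Definition o0 : 'I_4 := @Ordinal 4 0 isT.
Definition o1 : 'I_4 := @Ordinal 4 1 isT.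
Definition o2 : 'I_4 := @Ordinal 4 2 isT.
Definition o3 : 'I_4 := @Ordinal 4 3 isT.

Lemma ord4P (P : 'I_4 -> Prop) : P o0 -> P o1 -> P o2 -> P o3 -> forall l, P l.
Proof.
move=> h0 h1 h2 h3 [[|[|[|[|//]]]] lt4].
- by rewrite (_ : Ordinal lt4 = o0)//; apply: val_inj.
- by rewrite (_ : Ordinal lt4 = o1)//; apply: val_inj.
- by rewrite (_ : Ordinal lt4 = o2)//; apply: val_inj.
- by rewrite (_ : Ordinal lt4 = o3)//; apply: val_inj.
Qed.

(** The units [qi] and [- qi] separate the two coefficients, so that a slice
function determines its stem. *)
Lemma unit_affine_inj x y x' y' :
  (forall I, imag_units I -> x + I * y = x' + I * y') -> x = x' /\ y = y'.
Proof.
move=> E; have e1 := E _ imag_units_qi.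
have e2 := E _ (imag_unitsN imag_units_qi).
have F (f : quat R -> R) : f (x + qi * y) = f (x' + qi * y') by rewrite e1.
have F' (f : quat R -> R) : f (x + - qi * y) = f (x' + - qi * y') by rewrite e2.
have := F re; have := F imi; have := F imj; have := F imk.
have := F' re; have := F' imi; have := F' imj; have := F' imk.
by rewrite !qE => *; split; apply: quatP; lra.
Qed.

(** With [a] the value of [f] at a point of the slice of [I], the point
[a^-1 * q * a] lies on the slice of [a^-1 * I * a]; thus the star product takes the
value [a * G0 + I * a * G1], and [a = F0 + I * F1]. *)
Lemma star_induced Omega F0 F1 G0 G1 f g : circular_domain Omega ->
  induced_by Omega F0 F1 f -> induced_by Omega G0 G1 g ->
  induced_by Omega (fun p => F0 p * G0 p - F1 p * G1 p)
    (fun p => F0 p * G1 p + F1 p * G0 p) (star f g).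
Proof.
move=> hO fF gG I p hI OI.
have II := imag_unit_mul hI.
set a := f (slice_pt I p).
have aE : a = F0 p + I * F1 p by rewrite /a fF.
have E : F0 p * G0 p - F1 p * G1 p + I * (F0 p * G1 p + F1 p * G0 p) =
    a * G0 p + I * a * G1 p.
  rewrite aE !mulrDr !mulrDl !mulrA II mulN1r mulNr -!addrA; congr (_ + _).
  by rewrite addrC -!addrA addrCA; congr (_ + _); rewrite addrC -addrA.
rewrite /star -/a E; case: eqVneq => [->|a0]; first by rewrite mulr0 !mul0r addr0.
have ua : a \is a GRing.unit by [].
have hJ : imag_units (a^-1 * I * a).
  rewrite /imag_units /= expr2 !mulrA mulrK// -[a^-1 * I * I]mulrA II.
  by rewrite mulrN1 mulNr mulVr.
have sE : a^-1 * slice_pt I p * a = slice_pt (a^-1 * I * a) p.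
  rewrite /slice_pt mulrDr mulrDl; congr (_ + _).
    by rewrite -scalerAr mulr1 -scalerAl mulVr.
  by rewrite -scalerAr -scalerAl.
have OJ : Omega (slice_pt (a^-1 * I * a) p) by exact: circular_slice hO hI hJ OI.
by rewrite sE gG// mulrDr !mulrA mulrV// mul1r.
Qed.

Definition cmul (x y : quat R * quat R) : quat R * quat R :=
  (x.1 * y.1 - x.2 * y.2, x.1 * y.2 + x.2 * y.1).

Definition cpow (x : quat R * quat R) n := iter n (cmul x) (1, 0).

Lemma star_pow_induced Omega F0 F1 f n : circular_domain Omega ->
  induced_by Omega F0 F1 f ->
  induced_by Omega (fun p => (cpow (F0 p, F1 p) n).1)
    (fun p => (cpow (F0 p, F1 p) n).2) (star_pow f n).
Proof.
move=> hO fF; elim: n => [|n IH]; last exact: star_induced.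
by move=> I p _ _; rewrite /= mulr0 addr0.
Qed.

Lemma ccoord_cmul (x y : quat R * quat R) (z := cmul x y)
    (a := fun l => ccoord l x.1 x.2) (b := fun l => ccoord l y.1 y.2) :
  [/\ ccoord o0 z.1 z.2 = a o0 * b o0 - a o1 * b o1 - a o2 * b o2 - a o3 * b o3,
      ccoord o1 z.1 z.2 = a o0 * b o1 + a o1 * b o0 + a o2 * b o3 - a o3 * b o2,
      ccoord o2 z.1 z.2 = a o0 * b o2 - a o1 * b o3 + a o2 * b o0 + a o3 * b o1 &
      ccoord o3 z.1 z.2 = a o0 * b o3 + a o1 * b o2 - a o2 * b o1 + a o3 * b o0].
Proof.
have e0 q : q ord0 o0 = re q by [].
have e1 q : q ord0 o1 = imi q by [].
have e2 q : q ord0 o2 = imj q by [].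
have e3 q : q ord0 o3 = imk q by [].
rewrite /z /a /b /ccoord /cmul /= !(e0, e1, e2, e3) !qE.
split; apply: complex_eq; rewrite /=; ring.
Qed.

(** The powers of an element of the complexified quaternions lie in the plane
spanned by [1] and its vector part. *)
Lemma ccoord_cpow (x : quat R * quat R) (a := ccoord o0 x.1 x.2)
    (h := ccoord o1 x.1 x.2 ^+ 2 + ccoord o2 x.1 x.2 ^+ 2 + ccoord o3 x.1 x.2 ^+ 2) :
  exists p r : nat -> C, [/\ p 0 = 1, r 0 = 0,
    forall n, p n.+1 = a * p n - h * r n,
    forall n, r n.+1 = a * r n + p n &
    forall n, [/\ ccoord o0 (cpow x n).1 (cpow x n).2 = p n,
      ccoord o1 (cpow x n).1 (cpow x n).2 = r n * ccoord o1 x.1 x.2,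
      ccoord o2 (cpow x n).1 (cpow x n).2 = r n * ccoord o2 x.1 x.2 &
      ccoord o3 (cpow x n).1 (cpow x n).2 = r n * ccoord o3 x.1 x.2]].
Proof.
pose pr n := iter n (fun t : C * C => (a * t.1 - h * t.2, a * t.2 + t.1)) (1, 0).
exists (fun n => (pr n).1), (fun n => (pr n).2); split => // n.
elim: n => [|n [h0 h1 h2 h3]].
  have e0 q : q ord0 o0 = re q by [].
  have e1 q : q ord0 o1 = imi q by [].
  have e2 q : q ord0 o2 = imj q by [].
  have e3 q : q ord0 o3 = imk q by [].
  by rewrite /ccoord /= !mul0r !(e0, e1, e2, e3) !qE.
have [] := ccoord_cmul x (cpow x n).
rewrite h0 h1 h2 h3 [cpow x n.+1]iterS -/(cpow x n) => -> -> -> ->.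
rewrite [pr n.+1]iterS -/(pr n) /= -/a /h.
by split; ring.
Qed.

Lemma cvg_mulql (a : quat R) (u : nat -> quat R) L :
  u @ \oo --> L -> (fun n => a * u n) @ \oo --> a * L.
Proof.
move=> uL; suff ca : {for L, continuous (fun x : quat R => a * x)}.
  exact: (continuous_cvg _ ca uL).
have cl l : {for L, continuous (fun y : quat R => y ord0 l)}.
  exact: coord_continuous.
have ccst (k : R) l : {for L, continuous (fun y : quat R => k * y ord0 l)}.
  by apply: cvgM (cl l); apply: cvg_cst.
have c4 k0 k1 k2 k3 : {for L, continuous (fun y : quat R =>
    k0 * y ord0 o0 + k1 * y ord0 o1 + k2 * y ord0 o2 + k3 * y ord0 o3)}.
  exact: continuousD (continuousD (continuousD (ccst k0 o0) (ccst k1 o1))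
    (ccst k2 o2)) (ccst k3 o3).
apply: continuous_row; elim/ord4P.
- apply: (near_eq_continuous _ (c4 (re a) (- imi a) (- imj a) (- imk a))).
  by apply: (@filterE _ (nbhs L)) => y; apply/esym/(etrans (reM a y)); rewrite /re /imi /imj /imk; ring.
- apply: (near_eq_continuous _ (c4 (imi a) (re a) (- imk a) (imj a))).
  by apply: (@filterE _ (nbhs L)) => y; apply/esym/(etrans (imiM a y)); rewrite /re /imi /imj /imk; ring.
- apply: (near_eq_continuous _ (c4 (imj a) (imk a) (re a) (- imi a))).
  by apply: (@filterE _ (nbhs L)) => y; apply/esym/(etrans (imjM a y)); rewrite /re /imi /imj /imk; ring.
- apply: (near_eq_continuous _ (c4 (imk a) (- imj a) (imi a) (re a))).
  by apply: (@filterE _ (nbhs L)) => y; apply/esym/(etrans (imkM a y)); rewrite /re /imi /imj /imk; ring.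
Qed.

(** The convergence of the *-exponential on the slices of [qi] and [- qi] gives
the convergence of both parts of the stem. *)
Lemma exp_star_stem Omega F0 F1 G0 G1 f g p l : circular_domain Omega ->
  induced_by Omega F0 F1 f -> induced_by Omega G0 G1 g ->
  exp_star_is Omega f g -> stem_dom Omega p ->
  ccvg (fun n => \sum_(0 <= k < n) ((k`!%:R)^-1)%:C%C *
      ccoord l (cpow (F0 p, F1 p) k).1 (cpow (F0 p, F1 p) k).2)
    (ccoord l (G0 p) (G1 p)).
Proof.
move=> hO fF gG fg Dp.
pose X n : quat R := \sum_(0 <= k < n) (k`!%:R)^-1 *: (cpow (F0 p, F1 p) k).1.
pose Y n : quat R := \sum_(0 <= k < n) (k`!%:R)^-1 *: (cpow (F0 p, F1 p) k).2.
have lim I : imag_units I -> (fun n => X n + I * Y n) @ \oo --> G0 p + I * G1 p.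
  move=> hI; have OI := proj1 (stem_domP p hO hI) Dp.
  have := fg _ OI; rewrite (gG _ _ hI OI).
  rewrite (_ : series _ = (fun n => X n + I * Y n))//.
  apply/funext => n; rewrite /series /= mulr_sumr -big_split /=.
  apply: eq_bigr => k _.
  by rewrite (star_pow_induced k hO fF hI OI) scalerDr scalerAr.
have half (x y : quat R) : 2^-1 *: (x + qi * y + (x + - qi * y)) = x.
  rewrite mulNr addrACA subrr addr0 scalerDr -scalerDl.
  by rewrite (_ : _ + _ = 1) ?scale1r//; field.
have lu := lim _ imag_units_qi; have lv := lim _ (imag_unitsN imag_units_qi).
have XL : X @ \oo --> G0 p.
  have <- : (fun n => 2^-1 *: (X n + qi * Y n + (X n + - qi * Y n))) = X.
    by apply/funext => n; exact: half.
  by rewrite -[G0 p](half _ (G1 p)); exact: cvgZl_tmp (cvgD lu lv).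
have YL : Y @ \oo --> G1 p.
  have ii : - qi * qi = 1 :> quat R.
    by rewrite mulNr (imag_unit_mul imag_units_qi) opprK.
  have cancel (x y : quat R) : - qi * (x + qi * y - x) = y.
    by rewrite addrAC subrr add0r mulrA ii mul1r.
  have <- : (fun n => - qi * (X n + qi * Y n - X n)) = Y.
    by apply/funext => n; exact: cancel.
  by rewrite -(cancel (G0 p) (G1 p)); exact: cvg_mulql (cvgB lu XL).
have E n : \sum_(0 <= k < n) ((k`!%:R)^-1)%:C%C *
      ccoord l (cpow (F0 p, F1 p) k).1 (cpow (F0 p, F1 p) k).2 = ccoord l (X n) (Y n).
  rewrite /X /Y; elim: n => [|n IH].
    by rewrite !big_nil /ccoord !mxE.
  rewrite !big_nat_recr//= IH; apply: complex_eq; rewrite /ccoord /= !mxE !mul0r ?subr0 ?addr0//.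
split.
  under eq_fun do rewrite E.
  by apply: (@continuous_cvg _ _ _ _ _ X (fun y : quat R => y ord0 l) _ _ XL);
    exact: coord_continuous.
under eq_fun do rewrite E.
by apply: (@continuous_cvg _ _ _ _ _ Y (fun y : quat R => y ord0 l) _ _ YL);
  exact: coord_continuous.
Qed.

(** The powers of [a + v] stay in the span of [1] and [v], so the exponential
series splits into a scalar series and the multiple of [v] by the sum [rho] of
another one. *)
Lemma exp_star_components Omega F0 F1 G0 G1 f g p
    (a := ccoord o0 (F0 p) (F1 p)) (v := fun l => ccoord l (F0 p) (F1 p))
    (w := fun l => ccoord l (G0 p) (G1 p)) :
  circular_domain Omega ->
  induced_by Omega F0 F1 f -> induced_by Omega G0 G1 g ->
  exp_star_is Omega f g -> stem_dom Omega p ->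
  exists rho, [/\ w o1 = rho * v o1, w o2 = rho * v o2, w o3 = rho * v o3,
    w o0 ^+ 2 + w o1 ^+ 2 + w o2 ^+ 2 + w o3 ^+ 2 = cexp a ^+ 2 &
    v o1 ^+ 2 + v o2 ^+ 2 + v o3 ^+ 2 = 0 -> w o0 = cexp a].
Proof.
move=> hO fF gG fg Dp.
have lim l := exp_star_stem l hO fF gG fg Dp.
have [P [r [p0 r0 pS rS pr]]] := ccoord_cpow (F0 p, F1 p).
have [L [rho [PL rL LE L0]]] := exp_scalar_vector p0 r0 pS rS.
have e0 : w o0 = L.
  apply: ccvg_uniq (lim o0) _; apply: ccvg_eq PL _ => n.
  by apply: eq_bigr => k _; have [-> _ _ _] := pr k.
have el l : (forall n, ccoord l (cpow (F0 p, F1 p) n).1 (cpow (F0 p, F1 p) n).2 =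
    r n * v l) -> w l = rho * v l.
  move=> E; apply: ccvg_uniq (lim l) _.
  rewrite mulrC; apply: ccvg_eq (ccvgZ (v l) rL) _ => n.
  by rewrite mulr_sumr; apply: eq_bigr => k _; rewrite E; ring.
have e1 : w o1 = rho * v o1 by apply: el => n; have [] := pr n.
have e2 : w o2 = rho * v o2 by apply: el => n; have [] := pr n.
have e3 : w o3 = rho * v o3 by apply: el => n; have [] := pr n.
exists rho; split => //; last by rewrite e0; exact: L0.
by rewrite -LE e0 e1 e2 e3 /v /=; ring.
Qed.

End StemAlgebra.

(** * Symmetrizations, vector parts and factors Delta *)

Section SliceFunctions.
Context {R : realType}.
Local Notation C := (complex R).
Local Notation Re := (@complex.Re R).
Local Notation Im := (@complex.Im R).
Implicit Types (Omega : set (quat R)) (I x y q : quat R) (p : R * R) (l : 'I_4).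
Implicit Types (f g : quat R -> quat R) (F G : R * R -> quat R).

Lemma ccoord0E x y : ccoord o0 x y = (re x +i* re y)%C. Proof. by []. Qed.
Lemma ccoord1E x y : ccoord o1 x y = (imi x +i* imi y)%C. Proof. by []. Qed.
Lemma ccoord2E x y : ccoord o2 x y = (imj x +i* imj y)%C. Proof. by []. Qed.
Lemma ccoord3E x y : ccoord o3 x y = (imk x +i* imk y)%C. Proof. by []. Qed.
Definition ccoordE := (ccoord0E, ccoord1E, ccoord2E, ccoord3E).

Definition ccoord_sqnorm (x y : quat R) : C :=
  ccoord o0 x y ^+ 2 + ccoord o1 x y ^+ 2 + ccoord o2 x y ^+ 2 + ccoord o3 x y ^+ 2.

(** The symmetrization of [g] has the stem [G * G^c], whose vector part vanishes
and whose scalar part is the sum of the squares of the complex coordinates. *)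
Lemma symmetrization_stem Omega g : circular_domain Omega ->
  symmetrization_of Omega g (fun=> 1) ->
  exists G0 G1, induced_by Omega G0 G1 g /\
    forall p, stem_dom Omega p -> ccoord_sqnorm (G0 p) (G1 p) = 1.
Proof.
move=> hO [gc [[G0 [G1 [_ gG gcG]]] g1]]; exists G0, G1; split => // p Dp.
have sG := star_induced hO gG gcG.
have [] := @unit_affine_inj R (G0 p * qconj (G0 p) - G1 p * qconj (G1 p))
  (G0 p * qconj (G1 p) + G1 p * qconj (G0 p)) 1 0.
  move=> I hI; have OI := proj1 (stem_domP p hO hI) Dp.
  by rewrite mulr0 addr0 -(g1 _ OI) (sG I p hI OI).
move=> /(congr1 re) e0 /(congr1 re) e1.
move: e0 e1; rewrite /qconj !qE => e0 e1.
rewrite /ccoord_sqnorm !ccoordE; apply: complex_eq; rewrite !expr2 !cplxE /=.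
  by rewrite -[RHS]e0; ring.
by rewrite -[RHS]e1; ring.
Qed.

(** From [x = - I * y] the stem value is [('i - I) * y], and the norm of ['i - I]
in the complexified quaternions is ['i ^ 2 - I ^ 2 = 0]. *)
Lemma ccoord_sqnorm_eq0 I x y : imag_units I -> x + I * y = 0 -> ccoord_sqnorm x y = 0.
Proof.
move=> /imag_unitsP[r0 n1] h.
have E (f : quat R -> R) : f (x + I * y) = f 0 by rewrite h.
have := E re; have := E imi; have := E imj; have := E imk.
rewrite !qE r0 => e3 e2 e1 e0.
have x0 : re x = imi I * imi y + imj I * imj y + imk I * imk y by lra.
have x1 : imi x = - (imi I * re y + imj I * imk y - imk I * imj y) by lra.
have x2 : imj x = - (- imi I * imk y + imj I * re y + imk I * imi y) by lra.
have x3 : imk x = - (imi I * imj y - imj I * imi y + imk I * re y) by lra.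
rewrite /ccoord_sqnorm !ccoordE; apply: complex_eq; rewrite !expr2 !cplxE /= x0 x1 x2 x3.
  transitivity ((imi I ^+ 2 + imj I ^+ 2 + imk I ^+ 2 - 1) *
    (re y ^+ 2 + imi y ^+ 2 + imj y ^+ 2 + imk y ^+ 2)); first by ring.
  by rewrite n1 subrr mul0r.
by ring.
Qed.

(** The sum and the difference of the values at conjugate points of a slice lie
in its plane, and the planes of [qi] and [qj] meet in the reals only. *)
Lemma slice_preserving_real Omega f F0 F1 p : circular_domain Omega ->
  slice_preserving Omega f -> induced_by Omega F0 F1 f -> stem_dom Omega p ->
  F0 p = (re (F0 p))%:A /\ F1 p = (re (F1 p))%:A.
Proof.
move=> hO [_ sp] fF Dp.
have key I : imag_units I -> exists a b a' b' : R,
    F0 p + I * F1 p = a%:A + b *: I /\ F0 p - I * F1 p = a'%:A + b' *: I.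
  move=> hI; have OI := proj1 (stem_domP p hO hI) Dp.
  have ON := proj1 (stem_domP p hO (imag_unitsN hI)) Dp.
  have [|[a b] _ ab] := sp I hI (f (slice_pt I p)).
    by exists (slice_pt I p) => //; split => //; exists p.
  have [|[a' b'] _ ab'] := sp I hI (f (slice_pt (- I) p)).
    exists (slice_pt (- I) p) => //; split => //; rewrite slice_ptN.
    by exists (p.1, - p.2).
  exists a, b, a', b'; split; first by rewrite -fF.
  by rewrite -mulNr -(fF _ _ (imag_unitsN hI) ON).
have [a [b [a' [b' [e1 e2]]]]] := key _ imag_units_qi.
have [c [d [c' [d' [e3 e4]]]]] := key _ imag_units_qj.
have E1 (h : quat R -> R) : h (F0 p + qi * F1 p) = h (a%:A + b *: qi) by rewrite e1.
have E2 (h : quat R -> R) : h (F0 p - qi * F1 p) = h (a'%:A + b' *: qi) by rewrite e2.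
have E3 (h : quat R -> R) : h (F0 p + qj * F1 p) = h (c%:A + d *: qj) by rewrite e3.
have E4 (h : quat R -> R) : h (F0 p - qj * F1 p) = h (c'%:A + d' *: qj) by rewrite e4.
have := E1 imj; have := E2 imj; have := E1 imk; have := E2 imk.
have := E3 imi; have := E4 imi; have := E3 imk; have := E4 imk.
by rewrite !qE => *; split; apply: quatP; rewrite !qE; lra.
Qed.

Lemma vector_part_stem Omega g gv G0 G1 : circular_domain Omega ->
  induced_by Omega G0 G1 g -> vector_part_of Omega g gv ->
  induced_by Omega (fun p => qvec (G0 p)) (fun p => qvec (G1 p)) gv.
Proof.
move=> hO gG [f0 [f1 [f2 [f3 [[s0 s1 s2 s3] gE]]]]] I p hI OI.
have Dp : stem_dom Omega p by exists I.
have [[A0 [B0 [_ i0]]] _] := s0; have [[A1 [B1 [_ i1]]] _] := s1.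
have [[A2 [B2 [_ i2]]] _] := s2; have [[A3 [B3 [_ i3]]] _] := s3.
have [a0 b0] := slice_preserving_real hO s0 i0 Dp.
have [a1 b1] := slice_preserving_real hO s1 i1 Dp.
have [a2 b2] := slice_preserving_real hO s2 i2 Dp.
have [a3 b3] := slice_preserving_real hO s3 i3 Dp.
have [E0 E1] : G0 p = A0 p + A1 p * qi + A2 p * qj + A3 p * qk /\
    G1 p = B0 p + B1 p * qi + B2 p * qj + B3 p * qk.
  apply: unit_affine_inj => J hJ; have OJ := proj1 (stem_domP p hO hJ) Dp.
  have [e _] := gE _ OJ.
  rewrite -(gG _ _ hJ OJ) e i0// i1// i2// i3//.
  rewrite !mulrDl !mulrDr !mulrA (addrACA (A0 p)) (addrACA (A0 p + _)).
  by rewrite (addrACA (A0 p + _ + _)).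
have r0 : re (G0 p) = re (A0 p) by rewrite E0 a1 a2 a3 !qE; ring.
have r1 : re (G1 p) = re (B0 p) by rewrite E1 b1 b2 b3 !qE; ring.
have [_ ->] := gE _ OI; rewrite (gG _ _ hI OI) (i0 _ _ hI OI) a0 b0 -r0 -r1.
have vE x : qvec x = x - (re x)%:A.
  by apply: quatP; rewrite /qvec !qE; ring.
by rewrite !vE mulrBr opprD addrACA.
Qed.

(** This is the stem of [Delta q0] when [p0] is the point [slice_coord q0]. *)
Definition Delta_stem p0 p : C := (cplx p - cplx p0) * (cplx p - ((cplx p0)^*)%C).

Definition slice_coord q : R * R := (re q, qnorm (qvec q)).

Lemma slice_ptD I (z w : C) :
  slice_pt I (uncplx (z + w)) = slice_pt I (uncplx z) + slice_pt I (uncplx w).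
Proof. by rewrite /slice_pt /= cReD cImD !scalerDl addrACA. Qed.

Lemma slice_pt_scalar I (c : R) : slice_pt I (uncplx (c%:C)%C) = c%:A.
Proof. by rewrite /slice_pt /= scale0r addr0. Qed.

Lemma Delta_slice q0 I p : imag_units I ->
  Delta q0 (slice_pt I p) = slice_pt I (uncplx (Delta_stem (slice_coord q0) p)).
Proof.
move=> hI.
have pE : p = uncplx (cplx p) by case: p.
have n2 : qnorm q0 ^+ 2 = re q0 ^+ 2 + qnorm (qvec q0) ^+ 2.
  rewrite /qnorm !sqr_sqrtr; try by rewrite /qnormsq !addr_ge0 ?sqr_ge0.
  by rewrite /qnormsq /qvec !qE; ring.
have E : Delta_stem (slice_coord q0) p = cplx p ^+ 2 + ((-2 * re q0)%:C)%C * cplx p +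
    ((qnorm q0 ^+ 2)%:C)%C.
  rewrite n2 /Delta_stem /slice_coord /cplx; apply: complex_eq; rewrite !expr2 !cplxE /=; ring.
rewrite E !slice_ptD -slice_ptX// -slice_ptM// !slice_pt_scalar -pE /Delta.
congr (_ + _ + _); rewrite -scalerAr mulr1 -!scalerAl mul1r -scaleNr.
by rewrite mulr_natl -scaler_nat scalerA; congr (_ *: _); ring.
Qed.

Lemma slice_mul_stem I (w : C) x y : imag_units I ->
  slice_pt I (uncplx w) * (x + I * y) =
  (Re w *: x - Im w *: y) + I * (Re w *: y + Im w *: x).
Proof.
move=> /imag_unit_mul II; rewrite /slice_pt /= mulrDl !mulrDr.
rewrite -!scalerAl !mul1r mulrA II mulN1r -!scalerAr scalerN.
by rewrite [Im w *: (I * x) - _]addrC addrACA.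
Qed.

Lemma ccoord_scale l (w : C) x y :
  ccoord l (Re w *: x - Im w *: y) (Re w *: y + Im w *: x) = w * ccoord l x y.
Proof. by apply: complex_eq; rewrite !cplxE /ccoord /= !mxE; ring. Qed.

Lemma Delta_factor_stem Omega q0 m f ft F0 F1 T0 T1 p l : circular_domain Omega ->
  induced_by Omega F0 F1 f -> induced_by Omega T0 T1 ft ->
  (forall q, Omega q -> f q = Delta q0 q ^+ m * ft q) -> stem_dom Omega p ->
  ccoord l (F0 p) (F1 p) = Delta_stem (slice_coord q0) p ^+ m * ccoord l (T0 p) (T1 p).
Proof.
move=> hO fF tT fE Dp; set w := Delta_stem (slice_coord q0) p ^+ m.
have [-> ->] : F0 p = Re w *: T0 p - Im w *: T1 p /\
    F1 p = Re w *: T1 p + Im w *: T0 p.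
  apply: unit_affine_inj => I hI; have OI := proj1 (stem_domP p hO hI) Dp.
  by rewrite -(fF _ _ hI OI) (fE _ OI) Delta_slice// slice_ptX// (tT _ _ hI OI) slice_mul_stem.
exact: ccoord_scale.
Qed.

(** A stem with the right symmetry vanishes in its second part on the real axis,
so the choice of the unit does not matter there; the formula uses
[0^-1 * 0 = 0]. *)
Lemma induced_exists Omega F0 F1 : circular_domain Omega ->
  (forall p, stem_dom Omega p -> F0 (p.1, - p.2) = F0 p /\ F1 (p.1, - p.2) = - F1 p) ->
  exists f, induced_by Omega F0 F1 f.
Proof.
move=> hO sF.
exists (fun q => F0 (slice_coord q) + ((qnorm (qvec q))^-1 *: qvec q) * F1 (slice_coord q)).
move=> I p hI OI; have Dp : stem_dom Omega p by exists I.
have [s0 s1] := sF p Dp.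
rewrite /slice_coord re_slice_pt// qvec_slice_pt// qnorm_scale_unit// scalerA.
have [p0|p0|p0] := ltgtP p.2 0.
- rewrite ltr0_norm// s0 s1 invrN mulNr mulVf ?lt_eqF// scaleN1r.
  by rewrite mulrNN.
- by rewrite gtr0_norm// mulVf ?gt_eqF// scale1r -surjective_pairing.
- have f1 : F1 p = 0.
    have pE : (p.1, - p.2) = p by rewrite p0 oppr0 -p0 -surjective_pairing.
    have : F1 p = - F1 p by rewrite -s1 pE.
    move=> /eqP; rewrite -addr_eq0 -mulr2n -scaler_nat scaler_eq0 pnatr_eq0 /=.
    by move/eqP.
  by rewrite p0 normr0 -p0 -surjective_pairing f1 !mulr0.
Qed.

End SliceFunctions.

(** * Division of a symmetric function by Delta *)

Section Quotient.
Context {R : realType}.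
Local Notation C := (complex R).
Local Notation Re := (@complex.Re R).
Local Notation Im := (@complex.Im R).
Local Notation N := (@Normc.normc R).
Implicit Types (u : R * R -> C) (p q : R * R).

Lemma punctured_zero u p : ccont p u ->
  (\forall q \near p, cplx q != cplx p -> u q = 0) -> u p = 0.
Proof.
move=> cu u0.
have key (g : R * R -> R) : {for p, continuous g} ->
    (\forall q \near p, cplx q != cplx p -> g q = 0) -> g p = 0.
  move=> cg g0; apply/eqP; apply/negPn/negP => gp.
  have g1 : \forall q \near p, g q != 0 by exact: (cvgr_neq0 _ cg).
  have [d d0 H] := nbhs_normc (filterI g0 g1).
  have d2 : 0 < d / 2 by rewrite divr_gt0.
  have Nd : N (cplx (p.1 + d / 2, p.2) - cplx p) = d / 2.
    rewrite (_ : _ - _ = ((d / 2)%:C)%C).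
      by rewrite normc_real gtr0_norm.
    by apply: complex_eq; rewrite !cplxE /=; ring.
  have [] := H (p.1 + d / 2, p.2); first by rewrite Nd; lra.
  move=> h /eqP; apply; apply: h; rewrite -subr_eq0.
  by apply: normc_gt0; rewrite Nd.
case: cu => cr ci; apply: complex_eq.
  by apply: (key (Re \o u) cr); apply: filterS u0 => q h /h /= ->.
by apply: (key (Im \o u) ci); apply: filterS u0 => q h /h /= ->.
Qed.

Definition reflect p : R * R := (p.1, - p.2).

Lemma is_diff_reflect p : differentiable reflect p /\
  'd reflect p = reflect :> (R * R -> R * R).
Proof.
have dl a b : differentiable (dlin a b) p.
  exact/linear_differentiable/dlin_continuous.
have rE : reflect = (fun q => (dlin 1 0 q, dlin 0 (-1) q)).
  by apply/funext => -[a b]; rewrite /reflect /dlin /=; congr (_, _); ring.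
rewrite rE; split; first exact: differentiable_pair.
by rewrite diff_pair// !diff_lin//; exact: dlin_continuous.
Qed.

Lemma C1at_reflect (f : R * R -> R) p :
  (\forall q \near p, C1at f (reflect q)) ->
  [/\ C1at (f \o reflect) p,
    'D_(1, 0) (f \o reflect) p = 'D_(1, 0) f (reflect p) &
    'D_(0, 1) (f \o reflect) p = - 'D_(0, 1) f (reflect p)].
Proof.
move=> fC.
have D q : C1at f (reflect q) ->
    is_derive q (1, 0) (f \o reflect) ('D_(1, 0) f (reflect q)) /\
    is_derive q (0, 1) (f \o reflect) (- 'D_(0, 1) f (reflect q)).
  move=> /C1at_differentiable[df dfE]; have [dr drE] := is_diff_reflect q.
  have dc : differentiable (f \o reflect) q by exact: differentiable_comp.
  split; (split; first exact: diff_derivable); rewrite (deriveE _ dc) (diff_comp dr df) /=.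
    by rewrite drE dfE /dlin /reflect /=; ring.
  by rewrite drE dfE /dlin /reflect /=; ring.
have [[_ e1] [_ e2]] := D p (nbhs_singleton fC).
split => //; have [_ c1 c2] := nbhs_singleton fC.
have cr : {for p, continuous reflect}.
  exact: differentiable_continuous (proj1 (is_diff_reflect p)).
apply: (@C1at_intro _ _ ('D_(1, 0) f \o reflect) (- ('D_(0, 1) f \o reflect))).
- by apply: filterS fC => q /D.
- exact: continuous_comp cr c1.
- exact: continuousN (continuous_comp cr c2).
Qed.

(** The Schwarz reflection principle. *)
Lemma hol_reflect u p : (\forall q \near p, hol u (reflect q)) ->
  hol (fun q => ((u (reflect q))^*)%C) p.
Proof.
move=> hu; have [_ _ [e1 e2]] := nbhs_singleton hu.
have h1 : \forall q \near p, C1at (Re \o u) (reflect q).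
  by apply: filterS hu => q [].
have h2 : \forall q \near p, C1at (Im \o u) (reflect q).
  by apply: filterS hu => q [].
have [c1 a1 b1] := C1at_reflect h1; have [c2 a2 b2] := C1at_reflect h2.
have E1 : (Re \o (fun q => ((u (reflect q))^*)%C)) = (Re \o u) \o reflect.
  by apply/funext => q /=; case: (u _).
have E2 : (Im \o (fun q => ((u (reflect q))^*)%C)) = - ((Im \o u) \o reflect).
  by apply/funext => q; rewrite !fctE /=; case: (u _).
rewrite /hol /CR E1 E2; split; [exact: c1|exact: C1atN c2|].
have [d1 d2] := C1at_derivable c2.
by rewrite (deriveN d1) (deriveN d2) a1 b1 a2 b2 !opprK e1 e2 opprK.
Qed.

Lemma cplx_reflect p : cplx (reflect p) = ((cplx p)^*)%C. Proof. by []. Qed.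

Lemma cplx_inj : injective (@cplx R).
Proof. by move=> [a b] [c d] [-> ->]. Qed.

Lemma near_neq p (z : C) : cplx p != z -> \forall q \near p, cplx q != z.
Proof.
move=> pz; have d0 : 0 < N (cplx p - z).
  rewrite lt_neqAle normc_ge0 andbT eq_sym; apply: contra pz => /eqP /Normc.eq0_normc.
  by move/eqP; rewrite subr_eq0.
apply: filterS (near_normc p d0) => q; apply: contraTneq => ->.
by rewrite -normc_opp opprB ltxx.
Qed.

Lemma hol_Delta_stem p0 p : hol (Delta_stem p0) p.
Proof.
have h c := holD (hol_cplx p) (holN (hol_cst c p)).
exact: holM (h _) (h _).
Qed.

Lemma Delta_stem_eq0 p0 p : (Delta_stem p0 p == 0) = (cplx p == cplx p0) || (cplx p == ((cplx p0)^*)%C).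
Proof. by rewrite /Delta_stem mulf_eq0 !subr_eq0. Qed.

Lemma Delta_stem_conj p0 p : Delta_stem p0 (reflect p) = ((Delta_stem p0 p)^*)%C.
Proof.
by case: p0 => a b; case: p => x y; apply: complex_eq; rewrite /Delta_stem /cplx /=; ring.
Qed.

(** Away from [p0] and its conjugate the quotient is regular. At [p0] it is
extended by [hol_division], and at the conjugate point by reflection, which
keeps the real symmetry. *)
Lemma hol_div_Delta_stem (D : set (R * R)) u p0 : open D ->
  (forall p, D p -> D (reflect p)) -> D p0 -> p0.2 != 0 ->
  (forall p, D p -> hol u p) ->
  (forall p, D p -> u (reflect p) = ((u p)^*)%C) -> u p0 = 0 ->
  exists H, [/\ forall p, D p -> hol H p,
    forall p, D p -> H (reflect p) = ((H p)^*)%C &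
    forall p, D p -> u p = Delta_stem p0 p * H p].
Proof.
move=> oD sD Dp0 p0n hu su up0.
set z0 := cplx p0.
have z0c : z0 != (z0^*)%C.
  rewrite eq_complex /= eqxx /= -subr_eq0 opprK.
  by rewrite -mulr2n mulrn_eq0.
have near p : D p -> \forall q \near p, D q by move=> Dp; exact: open_nbhs_nbhs.
have hnear : \forall q \near p0, hol u q by apply: filterS (near p0 Dp0).
have [Q QH] := hol_division hnear up0.
set c := Q p0 * (z0 - (z0^*)%C)^-1.
(* The value at [p0] is the one that [hol_division] gives to the quotient. *)
pose H p := if cplx p == z0 then c else if cplx p == (z0^*)%C then (c^*)%C
  else u p * (Delta_stem p0 p)^-1.
have cj (a b : C) : ((a^*)%C == b) = (a == (b^*)%C).
  by apply/eqP/eqP => [<-|->]; rewrite conjcK.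
have Hs p : D p -> H (reflect p) = ((H p)^*)%C.
  move=> Dp; rewrite /H cplx_reflect !cj conjcK.
  have [->|n1] := eqVneq (cplx p) z0; first by rewrite (negbTE z0c).
  case: eqVneq => [_|n2]; first by rewrite conjcK.
  by rewrite su// Delta_stem_conj -fmorphV -rmorphM.
have reg p : D p -> cplx p != (z0^*)%C -> hol H p.
  move=> Dp n2; have [e|n1] := eqVneq (cplx p) z0.
    have {e}e : p = p0 by exact: cplx_inj.
    rewrite e in Dp n2 *.
    have [hQ _] := nbhs_singleton QH.
    have d0 : cplx p0 - (z0^*)%C != 0 by rewrite subr_eq0.
    have hL : hol (fun q => cplx q - (z0^*)%C) p0.
      exact: holD (hol_cplx p0) (holN (hol_cst _ p0)).
    have hV : hol (fun q => (cplx q - (z0^*)%C)^-1) p0 by exact: (holV d0 hL).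
    apply: (@hol_near_eq _ (fun q => Q q * (cplx q - (z0^*)%C)^-1)); last exact: holM.
    apply: filterS2 QH (near_neq n2) => q [_ uq] qn.
    rewrite /H; have [e'|n1] := eqVneq (cplx q) z0.
      by rewrite e' (cplx_inj e').
    rewrite (negbTE qn) uq /Delta_stem -/z0.
    have a1 : cplx q - z0 != 0 by rewrite subr_eq0.
    have a2 : cplx q - (z0^*)%C != 0 by rewrite subr_eq0.
    by move: (Q q) => t; field; rewrite a1 a2.
  have d0 : Delta_stem p0 p != 0 by rewrite Delta_stem_eq0 negb_or n1 n2.
  have hV : hol (fun q => (Delta_stem p0 q)^-1) p by exact: (holV d0 (hol_Delta_stem p0 p)).
  apply: (@hol_near_eq _ (fun q => u q * (Delta_stem p0 q)^-1)); last exact: holM (hu p Dp) hV.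
  apply: filterS2 (near_neq n1) (near_neq n2) => q q1 q2.
  by rewrite /H (negbTE q1) (negbTE q2).
exists H; split => // p Dp.
- have [e|n2] := eqVneq (cplx p) (z0^*)%C; last exact: reg.
  have rp : reflect p = p0 by apply: cplx_inj; rewrite cplx_reflect e conjcK.
  apply: (@hol_near_eq _ (fun q => ((H (reflect q))^*)%C)).
    by apply: filterS (near p Dp) => q Dq; rewrite Hs// conjcK.
  apply: hol_reflect.
  have nr : cplx (reflect p) != (z0^*)%C by rewrite rp.
  have cr : {for p, continuous reflect}.
    exact: differentiable_continuous (proj1 (is_diff_reflect p)).
  have := cr _ (near_neq nr); apply: filterS2 (near p Dp) => q Dq qn.
  by apply: reg => //; apply: sD.
- rewrite /H; have [e|n1] := eqVneq (cplx p) z0.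
    by rewrite (cplx_inj e) up0 /Delta_stem subrr !mul0r.
  have [e|n2] := eqVneq (cplx p) (z0^*)%C.
    have -> : p = reflect p0 by apply: cplx_inj; rewrite cplx_reflect.
    by rewrite su// up0 conjc0 Delta_stem_conj /Delta_stem subrr mul0r conjc0 mul0r.
  have d0 : Delta_stem p0 p != 0 by rewrite Delta_stem_eq0 negb_or n1 n2.
  by rewrite mulrCA divff// mulr1.
Qed.

End Quotient.

(** * Isolated zeros of the vector part *)

Section Main.
Context {R : realType}.
Local Notation C := (complex R).
Local Notation Re := (@complex.Re R).
Local Notation Im := (@complex.Im R).
Implicit Types (Omega : set (quat R)) (I x y q : quat R) (p : R * R) (l : 'I_4).
Implicit Types (f g : quat R -> quat R) (F G : R * R -> quat R).

Lemma ccoord_inj x y x' y' : (forall l, ccoord l x y = ccoord l x' y') -> x = x' /\ y = y'.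
Proof. by move=> E; split; apply/rowP => l; have [] := E l. Qed.

(** If [s] is the bilinear product of [t] and [v] and [h] that of [v] with itself,
then parallelism says [h t = s v]. Squaring gives [0 = s ^ 2 * h], so [s = 0] and
[t = 0]. *)
Lemma null_parallel (K : fieldType) (t1 t2 t3 v1 v2 v3 : K) :
  t1 ^+ 2 + t2 ^+ 2 + t3 ^+ 2 = 0 -> v1 ^+ 2 + v2 ^+ 2 + v3 ^+ 2 != 0 ->
  t1 * v2 = t2 * v1 -> t1 * v3 = t3 * v1 -> t2 * v3 = t3 * v2 ->
  [/\ t1 = 0, t2 = 0 & t3 = 0].
Proof.
move=> tt hn e12 e13 e23; set h := _ + _ in hn.
set s := v1 * t1 + v2 * t2 + v3 * t3.
have h1 : h * t1 = s * v1.
  transitivity (t1 * v1 * v1 + t1 * v2 * v2 + t1 * v3 * v3); first by rewrite /h; ring.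
  by rewrite e12 e13 /s; ring.
have h2 : h * t2 = s * v2.
  transitivity (t2 * v1 * v1 + t2 * v2 * v2 + t2 * v3 * v3); first by rewrite /h; ring.
  by rewrite -e12 e23 /s; ring.
have h3 : h * t3 = s * v3.
  transitivity (t3 * v1 * v1 + t3 * v2 * v2 + t3 * v3 * v3); first by rewrite /h; ring.
  by rewrite -e13 -e23 /s; ring.
have s0 : s = 0.
  have : h * s ^+ 2 = 0.
    transitivity ((h * t1) ^+ 2 + (h * t2) ^+ 2 + (h * t3) ^+ 2).
      by rewrite h1 h2 h3 /h; ring.
    by rewrite !exprMn -!mulrDr tt mulr0.
  by move/eqP; rewrite mulf_eq0 (negbTE hn) /= sqrf_eq0 => /eqP.
have z t v : h * t = s * v -> t = 0.
  by rewrite s0 mul0r => /eqP; rewrite mulf_eq0 (negbTE hn) /= => /eqP.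
by split; [exact: z h1|exact: z h2|exact: z h3].
Qed.

(** If the stem of the quotient vanishes at the zero, then by symmetry it also
vanishes at the conjugate point, so that another factor [Delta] can be split
off each coordinate. *)
Lemma Delta_factor_vanish Omega q0 m f ft T0 T1 : circular_domain Omega ->
  Omega q0 -> qnorm (qvec q0) != 0 ->
  holomorphic_stem (stem_dom Omega) T0 T1 -> induced_by Omega T0 T1 ft ->
  (forall q, Omega q -> f q = Delta q0 q ^+ m * ft q) ->
  (forall l, ccoord l (T0 (slice_coord q0)) (T1 (slice_coord q0)) = 0) ->
  exists ft', Delta_factor Omega q0 m.+1 f ft'.
Proof.
move=> hO Oq0 n0 hT tT fE Tz.
have oD := open_stem_dom hO; set D := stem_dom Omega in oD hT *.
have Dpt q : Omega q -> D (slice_coord q).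
  by move=> Oq; have [I hI qE] := slice_ptE q; exists I => //; rewrite -qE.
have sD p : D p -> D (reflect p) by exact: stem_dom_conj.
have symT l p : D p -> ccoord l (T0 (reflect p)) (T1 (reflect p)) =
    ((ccoord l (T0 p) (T1 p))^*)%C.
  move=> Dp; have [_ _ sT _] := hT; have [s0 s1] := sT p Dp.
  by rewrite /ccoord /reflect s0 s1 mxE.
have /choice[H HP] : forall l, exists H : R * R -> C,
    [/\ forall p, D p -> hol H p, forall p, D p -> H (reflect p) = ((H p)^*)%C &
    forall p, D p -> ccoord l (T0 p) (T1 p) = Delta_stem (slice_coord q0) p * H p].
  move=> l; apply: (hol_div_Delta_stem oD sD (Dpt _ Oq0) n0).
  - by move=> p Dp; exact: hol_stem oD hT Dp.
  - by move=> p Dp; exact: symT.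
  - exact: Tz.
have hS : holomorphic_stem D (fun p => \row_l Re (H l p)) (fun p => \row_l Im (H l p)).
  by apply: stem_of_hol => // p l Dp; have [h1 h2 _] := HP l; [exact: h1|exact: h2].
have [_ _ sS _] := hS.
have [ft' tS] := induced_exists hO sS.
exists ft'; split; first by exists (fun p => \row_l Re (H l p)), (fun p => \row_l Im (H l p)).
move=> q Oq; have [I hI qE] := slice_ptE q.
have Dq := Dpt q Oq; rewrite qE in Oq *.
rewrite (fE _ Oq) exprSr -mulrA; congr (_ * _).
rewrite Delta_slice// (tT _ _ hI Oq) (tS _ _ hI Oq) slice_mul_stem//.
have [-> ->//] : T0 (slice_coord q) = Re (Delta_stem (slice_coord q0) (slice_coord q)) *: (\row_l Re (H l (slice_coord q))) -
      Im (Delta_stem (slice_coord q0) (slice_coord q)) *: (\row_l Im (H l (slice_coord q))) /\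
    T1 (slice_coord q) = Re (Delta_stem (slice_coord q0) (slice_coord q)) *: (\row_l Im (H l (slice_coord q))) +
      Im (Delta_stem (slice_coord q0) (slice_coord q)) *: (\row_l Re (H l (slice_coord q))).
apply: ccoord_inj => l; rewrite ccoord_scale; have [_ _ ->//] := HP l.
by congr (_ * _); rewrite /ccoord !mxE; case: (H l _).
Qed.

Lemma qvec_split x : x = (re x)%:A + qvec x.
Proof. by apply: quatP; rewrite /qvec !qE; ring. Qed.

Lemma sqr1_real (z : C) : z ^+ 2 = 1 -> z = ((Re z)%:C)%C /\ (Re z = 1 \/ Re z = -1).
Proof.
move=> /eqP; rewrite sqrf_eq1 => /orP[]/eqP->; split=> //=; first by left.
  by apply: complex_eq; rewrite /= ?oppr0.
by right.
Qed.

(** Let [v] be the vector part of the logarithm and [T] the stem of the quotient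
of [gv] by the largest power of [Delta]. Since [gv] is a multiple of [v], so is
[T] near the zero, and by continuity also at the zero, where [T] is a null
vector. If [v] were not a null vector there, then [T] would vanish, against the
choice of the power. Hence [v] is null and the exponential has the scalar part
[cexp a], while its vector part vanishes at the zero. *)
Lemma isolated_zero_value Omega f g gv F0 F1 G0 G1 q0 : circular_domain Omega ->
  holomorphic_stem (stem_dom Omega) F0 F1 -> induced_by Omega F0 F1 f ->
  induced_by Omega G0 G1 g ->
  (forall p, stem_dom Omega p -> ccoord_sqnorm (G0 p) (G1 p) = 1) ->
  vector_part_of Omega g gv -> exp_star_is Omega f g ->
  nonreal_isolated_zero Omega gv q0 ->
  g q0 = (Re (cexp (ccoord o0 (F0 (slice_coord q0)) (F1 (slice_coord q0)))))%:A.
Proof.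
move=> hO hF fF gG G1' gvP fg [_ _ [ Oq0 nr] [m [ft [[srft ftE] mmax ft0]]]].
have [T0 [T1 [hT tT]]] := srft.
have oD := open_stem_dom hO.
have [J hJ q0E] := slice_ptE q0; set p0 := slice_coord q0.
have OJ : Omega (slice_pt J p0) by rewrite -q0E.
have Dp0 : stem_dom Omega p0 by exists J.
have n0 : qnorm (qvec q0) != 0.
  apply/eqP => n0; apply: nr; rewrite /qreal /= q0E n0 qvec_slice_pt//=.
  by rewrite scale0r.
have T00 : T0 p0 + J * T1 p0 = 0 by rewrite -(tT _ _ hJ OJ) -q0E.
have vS := vector_part_stem hO gG gvP.
have dT p l : stem_dom Omega p -> ccoord l (qvec (G0 p)) (qvec (G1 p)) =
    Delta_stem p0 p ^+ m * ccoord l (T0 p) (T1 p).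
  by move=> Dp; exact: (Delta_factor_stem l hO vS tT ftE Dp).
have V0 p : ccoord o0 (qvec (G0 p)) (qvec (G1 p)) = 0.
  by rewrite ccoordE /qvec !quatE.
have V1 p : ccoord o1 (qvec (G0 p)) (qvec (G1 p)) = ccoord o1 (G0 p) (G1 p).
  by rewrite !ccoordE /qvec !quatE.
have V2 p : ccoord o2 (qvec (G0 p)) (qvec (G1 p)) = ccoord o2 (G0 p) (G1 p).
  by rewrite !ccoordE /qvec !quatE.
have V3 p : ccoord o3 (qvec (G0 p)) (qvec (G1 p)) = ccoord o3 (G0 p) (G1 p).
  by rewrite !ccoordE /qvec !quatE.
have cont l : ccont p0 (fun p => ccoord l (T0 p) (T1 p)).
  exact: hol_ccont (hol_stem l oD hT Dp0).
have contF l : ccont p0 (fun p => ccoord l (F0 p) (F1 p)).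
  exact: hol_ccont (hol_stem l oD hF Dp0).
have nz : \forall p \near p0, cplx p != cplx p0 -> stem_dom Omega p /\ Delta_stem p0 p ^+ m != 0.
  have Dn : \forall p \near p0, stem_dom Omega p by exact: open_nbhs_nbhs.
  have z0c : cplx p0 != ((cplx p0)^*)%C.
    by rewrite eq_complex /= eqxx /= -subr_eq0 opprK -mulr2n mulrn_eq0.
  apply: filterS2 Dn (near_neq z0c) => p Dp n2 n1; split => //.
  by rewrite expf_neq0// Delta_stem_eq0 negb_or n1 n2.
pose T l := ccoord l (T0 p0) (T1 p0).
pose v l := ccoord l (F0 p0) (F1 p0).
have T0z : T o0 = 0.
  apply: (punctured_zero (cont o0)); apply: filterS nz => p nz /nz[Dp dn].
  by have := dT p o0 Dp; rewrite V0 => /esym/eqP; rewrite mulf_eq0 (negbTE dn) => /eqP.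
(* [gv] is both [Delta ^ m] times [T] and [rho] times [v]. *)
have par i j : i \in [:: o1; o2; o3] -> j \in [:: o1; o2; o3] -> T i * v j = T j * v i.
  move=> hi hj; apply/eqP; rewrite -subr_eq0; apply/eqP.
  have cd : ccont p0 (fun p => ccoord i (T0 p) (T1 p) * ccoord j (F0 p) (F1 p) -
      ccoord j (T0 p) (T1 p) * ccoord i (F0 p) (F1 p)).
    exact: ccontB (ccontM (cont i) (contF j)) (ccontM (cont j) (contF i)).
  apply: (punctured_zero cd); apply: filterS nz => p nz /nz[Dp dn].
  have [rho [r1 r2 r3 _ _]] := exp_star_components hO fF gG fg Dp.
  have r k : k \in [:: o1; o2; o3] ->
      Delta_stem p0 p ^+ m * ccoord k (T0 p) (T1 p) = rho * ccoord k (F0 p) (F1 p).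
    rewrite !inE => /or3P[]/eqP->; rewrite -dT//.
    - by rewrite V1.
    - by rewrite V2.
    - by rewrite V3.
  apply: (mulfI dn); rewrite mulr0 mulrBr !mulrA (r i hi) (r j hj); ring.
have h0 : v o1 ^+ 2 + v o2 ^+ 2 + v o3 ^+ 2 = 0.
  apply/eqP; apply/negPn/negP => hn.
  have tt := ccoord_sqnorm_eq0 hJ T00.
  have {}tt : T o1 ^+ 2 + T o2 ^+ 2 + T o3 ^+ 2 = 0.
    by move: tt; rewrite /ccoord_sqnorm -/(T o0) T0z expr0n add0r.
  have m1 : o1 \in [:: o1; o2; o3] by rewrite !inE eqxx.
  have m2 : o2 \in [:: o1; o2; o3] by rewrite !inE eqxx.
  have m3 : o3 \in [:: o1; o2; o3] by rewrite !inE eqxx !orbT.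
  have [t1 t2 t3] := null_parallel tt hn (par _ _ m1 m2) (par _ _ m1 m3) (par _ _ m2 m3).
  have Tz l : T l = 0 by move: l; apply: ord4P.
  have [ft' /mmax] := Delta_factor_vanish hO Oq0 n0 hT tT ftE Tz.
  by rewrite ltnn.
have [rho [_ _ _ csqE /(_ h0) wE]] := exp_star_components hO fF gG fg Dp0.
have E2 : cexp (v o0) ^+ 2 = 1 by rewrite -csqE; exact: G1'.
have [Ere _] := sqr1_real E2.
have gv0 : qvec (G0 p0) + J * qvec (G1 p0) = 0.
  by rewrite -(vS _ _ hJ OJ) -q0E (ftE _ Oq0) ft0 mulr0.
rewrite [in LHS]q0E (gG _ _ hJ OJ) (qvec_split (G0 p0)) (qvec_split (G1 p0)).
rewrite mulrDr addrACA gv0 addr0 -/p0.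
have [-> ->] : re (G0 p0) = Re (cexp (v o0)) /\ re (G1 p0) = 0.
  by move: wE; rewrite -/(v o0) Ere ccoord0E => -[-> ->].
by rewrite scale0r mulr0 addr0.
Qed.

Lemma slice_coord_continuous : continuous (@slice_coord R).
Proof.
move=> q.
have c l : {for q, continuous (fun y : quat R => y ord0 l)} by exact: coord_continuous.
have E : (fun x : quat R => qnorm (qvec x)) = (@Num.sqrt R) \o
    ((fun x : quat R => x ord0 o1) * (fun x : quat R => x ord0 o1) +
     (fun x : quat R => x ord0 o2) * (fun x : quat R => x ord0 o2) +
     (fun x : quat R => x ord0 o3) * (fun x : quat R => x ord0 o3)).
  apply/funext => x; rewrite /qnorm /=; congr Num.sqrt.
  by rewrite /qnormsq /qvec !quatE expr0n add0r !expr2.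
have cn : {for q, continuous (fun x : quat R => qnorm (qvec x))}.
  rewrite E; apply: continuous_comp; last exact: sqrt_continuous.
  exact: continuousD (continuousD (continuousM (c o1) (c o1))
    (continuousM (c o2) (c o2))) (continuousM (c o3) (c o3)).
exact: cvg_pair (c o0) cn.
Qed.

(** The image is an interval that does not contain [0]. *)
Lemma sign_connected (X : topologicalType) (A : set X) (e : X -> R) :
  connected A -> (forall x : X, A x -> {for x, continuous e}) ->
  (forall x : X, A x -> e x = 1 \/ e x = -1) ->
  forall x y : X, A x -> A y -> e x = e y.
Proof.
move=> cA ce se.
have cw : {within A, continuous e}.
  by apply: continuous_in_subspaceT => x /set_mem; exact: ce.
have /connected_intervalP iA := connected_continuous_connected cA cw.
have no (x y : X) : A x -> A y -> e x = -1 -> e y = 1 -> False.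
  move=> Ax Ay ex ey.
  have [z Az ez] : (e @` A) 0.
    apply: (iA (e x) (e y)); [by exists x|by exists y|].
    by rewrite ex ey; apply/andP; split; lra.
  by have := se z Az; rewrite ez => -[] ?; lra.
move=> x y Ax Ay; have := se x Ax; have := se y Ay.
move=> [ey|ey] [ex|ex]; rewrite ?ex ?ey//; exfalso.
- exact: (no x y).
- exact: (no y x).
Qed.

End Main.

Theorem proposition6p6 (R : realType) (Omega : set (quat R))
    (g gv : quat R -> quat R)
    (hOmega : circular_domain Omega)
    (hg : slice_regular Omega g)
    (hgs : symmetrization_of Omega g (fun=> 1))
    (hgv : vector_part_of Omega g gv)
    (hlog : has_star_log Omega g) :
  (slice_domain Omega ->
     forall q0, nonreal_isolated_zero Omega gv q0 -> g q0 = 1) /\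
  (product_domain Omega ->
     forall q0 q1, nonreal_isolated_zero Omega gv q0 ->
       nonreal_isolated_zero Omega gv q1 ->
       (g q0 = 1 /\ g q1 = 1) \/ (g q0 = -1 /\ g q1 = -1)).
Proof.
have [f [F0 [F1 [hF fF]]] fg] := hlog.
have [G0 [G1 [gG csq1]]] := symmetrization_stem hOmega hgs.
have oD := open_stem_dom hOmega.
have Dpt q : Omega q -> stem_dom Omega (slice_coord q).
  by move=> Oq; have [I hI qE] := slice_ptE q; exists I => //; rewrite -qE.
pose e (q : quat R) : R := complex.Re (cexp (ccoord o0 (F0 (slice_coord q)) (F1 (slice_coord q)))).
have eE q : nonreal_isolated_zero Omega gv q -> g q = (e q)%:A.
  exact: isolated_zero_value hOmega hF fF gG csq1 hgv fg.
have e1 q : Omega q -> e q = 1 \/ e q = -1.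
  move=> /Dpt Dq; have [rho [_ _ _ E _]] := exp_star_components hOmega fF gG fg Dq.
  have E2 : cexp (ccoord o0 (F0 (slice_coord q)) (F1 (slice_coord q))) ^+ 2 = 1.
    by rewrite -E; exact: csq1.
  by have [_] := sqr1_real E2.
have ce q : Omega q -> {for q, continuous e}.
  move=> /Dpt Dq; have [c0 c1] := hol_ccont (hol_stem o0 oD hF Dq).
  have ct : {for q, continuous (@slice_coord R)} by exact: slice_coord_continuous.
  have d0 := continuous_comp ct c0; have d1 := continuous_comp ct c1.
  have x0 := continuous_comp d0 (@continuous_expR R _).
  have x1 := continuous_comp d1 (@continuous_cos R _).
  exact: continuousM x0 x1.
have [_ _ cO _] := hOmega.
have cst := sign_connected cO ce e1.
split=> [[_ [x [Ox rx]]] q0 z0|_ q0 q1 z0 z1].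
  have [_ _ [ Oq0 _] _] := z0.
  have Dx := Dpt x Ox.
  have p2 : (slice_coord x).2 = 0 by rewrite /slice_coord /= rx /qnorm /qnormsq !quatE expr0n !addr0 sqrtr0.
  have f1 : re (F1 (slice_coord x)) = 0.
    have [_ _ sF _] := hF; have [_] := sF _ Dx.
    rewrite p2 oppr0 -[X in (_, X)]p2 -surjective_pairing => /(congr1 re).
    by rewrite reN => h; lra.
  have ex : e x = 1.
    have [//|] := e1 x Ox; rewrite /e ccoord0E /cexp /= f1 cos0 mulr1.
    by have := expR_gt0 (re (F0 (slice_coord x))); lra.
  by rewrite (eE q0 z0) (cst q0 x Oq0 Ox) ex scale1r.
have [_ _ [ Oq0 _] _] := z0; have [_ _ [Oq1 _] _] := z1.
rewrite (eE q0 z0) (eE q1 z1) (cst q1 q0 Oq1 Oq0).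
by have [->|->] := e1 q0 Oq0; [left|right]; rewrite ?scale1r ?scaleN1r.
Qed.
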